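(* Let $n,s$ be integers satisfying $s\leq \frac{n}{2^{17}\log n}$. Let $\mathcal{F}\subset \Sigma_n$ be a family of permutations such that $\nu(\mathcal{F})<s$ and $\tau(\mathcal{F})\geq s$. Then $|\mathcal{F}|\leq (s-1)(n-1)!-d_{n,1}+1$. Moreover, in the case of equality, $\mathcal{F}$ is of the form $\rho\mathcal{F}_0\pi$ or $\rho\mathcal{F}_0^{-1}\pi$ for some $\rho,\pi\in\Sigma_n$, where \[\mathcal{F}_0=\bigcup_{i=2}^{s-1}\Sigma_n[(1,i)]\cup\Sigma_{n,\sigma}[(1,1)]\cup\{\sigma\}\] for some permutation $\sigma$ satisfying $\sigma(1)\notin [s-1]$.
   Context: $\Sigma_n$ is the set of permutations of $[n]$; a permutation is identified with its graph $\{(i,\sigma(i))\}\subset[n]^2$, two permutations intersect iff they agree at some point, and $\nu(\mathcal{F})$ is the maximum number of pairwise non-intersecting members of $\mathcal{F}$. The covering number $\tau(\mathcal{F})$ is the smallest size of a set $X\subset[n]^2$ of pairs such that every permutation in $\mathcal{F}$ contains some pair of $X$ (i.e. $\pi(x)=y$ for some $(x,y)\in X$). $\Sigma_n[(x,y)]$ is the set of permutations mapping $x$ to $y$; $\Sigma_{n,\sigma}$ is the set of permutations intersecting $\sigma$, and $\Sigma_{n,\sigma}[(1,1)]$ is the set of those mapping $1$ to $1$. $d_{n,1}$ is the number of derangements (fixed-point-free permutations) $\pi$ of $[n]$ with $\pi(x)=y$ for a fixed pair $x\neq y$. For a family $\mathcal G$, $\rho\mathcal G\pi=\{\rho\circ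 g\circ\pi: g\in\mathcal G\}$ and $\mathcal G^{-1}=\{g^{-1}:g\in\mathcal G\}$. *)

(* Defs.v *)
From Stdlib Require Reals.
From HB Require Import structures.
From mathcomp Require Import all_boot all_order all_algebra all_fingroup.
Set Implicit Arguments. Unset Strict Implicit. Unset Printing Implicit Defensive.

(* Points of [n] = {1,...,n} are represented by 'I_n = {0,...,n-1};
   the paper's point k corresponds to the ordinal of value k-1.
   Sigma_n is {perm 'I_n}. Note: in MathComp, (p * q) x = q (p x). *)

Section Perms.
Variable n : nat.
Local Notation P := {perm 'I_n}.

Definition intersecting (p q : P) : bool := [exists x, p x == q x].

Definition pairwise_nonint (G : {set P}) : bool :=
  [forall p in G, forall q in G, (p != q) ==> ~~ intersecting p q].

Definition nu (F : {set P}) : nat :=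
  \max_(G : {set P} | (G \subset F) && pairwise_nonint G) #|G|.

Definition covers (F : {set P}) (X : {set 'I_n * 'I_n}) : bool :=
  [forall p in F, exists xy in X, p xy.1 == xy.2].

(* tau(F): smallest size of a cover.  (If no cover exists, which only
   happens for n = 0, the value defaults to n*n+1, standing for infinity.) *)
Definition tau (F : {set P}) : nat :=
  \big[minn/(n * n).+1]_(X : {set 'I_n * 'I_n} | covers F X) #|X|.

Definition Sigma_pair (x y : 'I_n) : {set P} := [set p : P | p x == y].

Definition Sigma_int (sigma : P) : {set P} := [set p : P | intersecting p sigma].

Definition is_pt1 (x : 'I_n) : bool := val x == 0.

(* F_0 = U_{i=2}^{s-1} Sigma_n[(1,i)]  u  Sigma_{n,sigma}[(1,1)]  u  {sigma};
   paper point i in {2,...,s-1} <-> ordinal value in {1,...,s-2}. *)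
Definition F0 (s : nat) (sigma : P) : {set P} :=
  (\bigcup_(x | is_pt1 x)
     ((\bigcup_(y : 'I_n | (0 < val y) && (val y < s.-1)) Sigma_pair x y)
      :|: (Sigma_int sigma :&: Sigma_pair x x)))
  :|: [set sigma].

(* sigma(1) notin [s-1] = {1,...,s-1}  <->  value of sigma(pt1) >= s-1 *)
Definition sigma_cond (s : nat) (sigma : P) : bool :=
  [forall x, is_pt1 x ==> (s.-1 <= val (sigma x))].

(* rho G pi = { rho o g o pi : g in G } (o = usual composition);
   in MathComp's convention rho o g o pi is written pi * g * rho. *)
Definition lrcomp (rho pi : P) (G : {set P}) : {set P} :=
  [set (pi * g * rho)%g | g in G].

Definition setinv (G : {set P}) : {set P} := [set g^-1%g | g in G].

(* d_{n,1}: derangements pi of [n] with pi(x) = y for a fixed pair x <> y;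
   we take x = 1, y = 2 (ordinals 0 and 1; meaningful for n >= 2). *)
Definition d_n1 : nat :=
  #|[set p : P | [forall i, p i != i] &&
        [forall x, is_pt1 x ==> (val (p x) == 1)]]|.
End Perms.

Definition size_cond (n s : nat) : Prop :=
  Rdefinitions.Rle (Raxioms.INR s)
    (Rdefinitions.Rdiv (Raxioms.INR n)
       (Rdefinitions.Rmult (Rpow_def.pow (Raxioms.INR 2) 17)
                           (Rpower.ln (Raxioms.INR n)))).

(* Main.v *)
From Stdlib Require Import Reals Lra.
Require Import Defs.
From HB Require Import structures.
From mathcomp Require Import all_boot all_order all_algebra all_fingroup.
From mathcomp Require Import zify.
Set Implicit Arguments. Unset Strict Implicit. Unset Printing Implicit Defensive.

(** Identify a permutation with its graph, a set of n cells of the n x n grid. A family G of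
    permutations above a kernel A is spread if fixing b further cells cuts G by a factor R^b.
    Colour the cells at random with s blocks of O(log n) colours: revealing one colour at a time
    halves the uncovered parts of the members of a spread family with constant probability, so
    each of s spread families with disjoint kernels has, with probability above 1 - 1/s, a member
    whose part outside the kernel is coloured by its own block. Hence nu(F) < s forces the kernels
    of the spread subfamilies of F to contain no s disjoint sets, while only a tiny part of F lies
    above no small kernel.

    Saturate the set of kernels. Its t <= s - 1 singletons give t stars, and its other minimal
    members cover at most (s - 1 - t)(n-1)!/16 permutations. As d_{n,1} is at most 3(n-1)!/4, a
    family of size at least (s-1)(n-1)! - d_{n,1} + 1 has t = s - 1, and it has a member p outside
    these stars because tau(F) >= s. If each of the s - 1 stars kept a member avoiding p (and the
    other stars), then p could be completed to s disjoint members of F, again by the colouring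
    argument; so some star loses all its d_{n,1} permutations avoiding p. A second permutation
    outside the stars would cost more than it brings, and equality forces the stars to be pairwise
    disjoint, that is, their cells to lie on one line of the grid. *)

(** * Random colourings *)

Section Coloring.
Variables X C I : finType.
Implicit Types (c : {ffun X -> C}) (Q : {set C}) (A : {set I}) (T : I -> {set X}).

(** Conditioning on revealed colours: [c] and [c0] have the same class for each colour of [Q];
    elsewhere [c] is free among the other colours. *)
Definition agree_on Q c0 c : bool :=
  [forall x, (c x == c0 x) || ((c x \notin Q) && (c0 x \notin Q))].

Definition color_class (a : C) c : {set X} := [set x | c x == a].

Lemma agree_onP Q c0 c :
  reflect (forall x, c x = c0 x \/ c x \notin Q /\ c0 x \notin Q) (agree_on Q c0 c).
Proof.
apply: (iffP forallP) => H x.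
  by case/orP: (H x) => [/eqP|/andP]; [left|right].
by case: (H x) => [->|[-> ->]]; rewrite ?eqxx ?orbT.
Qed.

(** Revealing one more colour [a] splits the conditioned event by the class of [a]; [c1] is any
    representative of a part. *)
Lemma agree_on_class a Q c0 c1 c : a \notin Q -> agree_on Q c0 c1 ->
  agree_on (a |: Q) c1 c = agree_on Q c0 c && (color_class a c == color_class a c1).
Proof.
move=> aQ /agree_onP h1; apply/agree_onP/andP => [h|[/agree_onP h /eqP hW] x].
  split.
    apply/agree_onP => x; move: (h x) (h1 x); rewrite !in_setU1 !negb_or.
    case=> [->|[/andP[_ cQ] /andP[_ c1Q]]] //.
    by case=> [<-|[_ c0Q]]; right; split.
  apply/eqP/setP => x; rewrite !inE; case: (h x) => [->//|].
  by rewrite !in_setU1 !negb_or => -[/andP[/negPf-> _] /andP[/negPf-> _]].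
move/setP/(_ x): hW; rewrite !inE !negb_or.
case: (h x) (h1 x) => [->|[cQ c0Q]].
  case=> [->|[c1Q c0Q]]; first by left.
  case: (c0 x =P a) => [-> /esym/eqP->|/eqP _ /esym/negbT n1]; first by left.
  by right; rewrite n1 c0Q c1Q.
have c1Q : c1 x \notin Q by case: (h1 x) => [->|[]].
move=> _; case: (c x =P a) => [-> /esym/eqP->|/eqP _ /esym/negbT n1]; first by left.
by right; rewrite n1 cQ c1Q.
Qed.

(** Bounds the fibres of a recolouring of [U], which forgets only the colours on [U]. *)
Lemma card_agree_off (U : {set X}) (c0 : {ffun X -> C}) :
  #|[set c : {ffun X -> C} | [forall x, (x \notin U) ==> (c x == c0 x)]]| = #|C| ^ #|U|.
Proof.
pose F x : pred C := if x \in U then predT else pred1 (c0 x).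
rewrite (_ : #|_| = #|family F|).
  rewrite card_family foldrE big_map big_enum /= (bigID (mem U)) /= [X in _ * X]big1.
    rewrite muln1 -prod_nat_const; apply: eq_bigr => x xU.
    by rewrite /F xU; apply: eq_card.
  by move=> x /negPf xU; rewrite /F xU card1.
apply: eq_card => c; rewrite inE; apply/forallP/familyP => h x; move: (h x);
  rewrite /F; by case: (x \in U).
Qed.

(** The minimum fragment of the Park-Pham argument: the smallest remainder outside [W] of a member
    contained in [W :|: T i]. *)
Definition fragment A T (W : {set X}) (i : I) : {set X} :=
  T [arg min_(k < i | (k \in A) && (T k \subset W :|: T i)) #|T k :\: W|] :\: W.

Lemma fragmentP A T W i : i \in A ->
  exists k, [/\ k \in A, T k \subset W :|: T i, fragment A T W i = T k :\: W &
    forall k', k' \in A -> T k' \subset W :|: T i ->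
      #|fragment A T W i| <= #|T k' :\: W| ].
Proof.
move=> iA; rewrite /fragment; case: arg_minnP; first by rewrite iA subsetUr.
by move=> k /andP[kA kT] kmin; exists k; split=> // k' k'A k'T; apply/kmin/andP.
Qed.

Lemma fragment_sub A T W i : i \in A -> fragment A T W i \subset T i.
Proof. by case/(fragmentP T W) => k [_ kT -> _]; rewrite subDset. Qed.

Definition recolor (a : C) (U : {set X}) c : {ffun X -> C} :=
  [ffun x => if x \in U then a else c x].

Lemma color_class_recolor a U c : color_class a (recolor a U c) = color_class a c :|: U.
Proof. by apply/setP => x; rewrite !inE ffunE orbC; case: (x \in U); rewrite ?eqxx. Qed.

(** The choice depends on the colouring only: a recoloured colouring determines one member, among
    whose subsets the recoloured fragment must be found. *)
Definition mono_member A T a c : option I :=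
  [pick i | (i \in A) && (T i \subset color_class a c)].

(* After recolouring a minimal fragment U with a, every T i inside the class of a contains U:
   it can only leave a part of U outside the old class, and U is minimal. *)
Lemma fragment_sub_mono_member A T a c i : i \in A ->
  exists2 k, mono_member A T a (recolor a (fragment A T (color_class a c) i) c) = Some k &
    (k \in A) && (fragment A T (color_class a c) i \subset T k).
Proof.
move=> iA; set W := color_class a c; set U := fragment A T W i.
have [k0 [k0A k0T Ueq Umin]] := fragmentP T W iA.
rewrite /mono_member color_class_recolor -/W; case: pickP => [k /andP[kA kT]|/(_ k0)].
  exists k => //; rewrite kA /=.
  have sUT : U \subset T i by apply: fragment_sub.
  have kWT : T k \subset W :|: T i by apply: subset_trans kT _; apply: setUS.
  have dU : T k :\: W \subset U by rewrite subDset.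
  have /eqP <- : T k :\: W == U by rewrite eqEcard dU; apply: Umin.
  by apply: subsetDl.
by rewrite k0A /= -subDset /U Ueq subxx.
Qed.

(** Double counting of pairs of a colouring and a fragment [U]. Recolouring [U] with [a] makes it
    one of the at most [2^k] subsets of the member chosen by [mono_member], and merges at most
    [#|C|^#|U|] colourings; by [hB], at most [K / (#|C|^#|U| * b)] indices have [U] inside their
    set. *)
Lemma sum_large_fragments A T Q c0 a (y k b K : nat) :
  a \notin Q -> (forall i x, i \in A -> x \in T i -> c0 x \notin Q) ->
  (forall i, i \in A -> #|T i| <= k) ->
  (forall B : {set X}, y <= #|B| ->
     #|[set i in A | B \subset T i]| * #|C| ^ #|B| * b <= K) ->
  (\sum_(c | agree_on Q c0 c)
     #|[set i in A | y <= #|fragment A T (color_class a c) i|]|) * b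
   <= K * (2 ^ k * #|[set c | agree_on Q c0 c]|).
Proof.
move=> aQ TQ Tk hB.
pose fr c i := fragment A T (color_class a c) i.
pose big c : {set {set X}} := [set fr c i | i in A & y <= #|fr c i|].
pose host c (U : {set X}) := if mono_member A T a c is Some i then
   (i \in A) && (U \subset T i) else false.
have step1 c : #|[set i in A | y <= #|fr c i|]| <=
    \sum_(U in big c) #|[set i in A | U \subset T i]|.
  rewrite -[X in X <= _]sum1_card.
  rewrite (partition_big (fr c) (mem (big c))) /=; last first.
    by move=> i; rewrite inE => /andP[iA yi]; apply: imset_f; rewrite inE iA.
  apply: leq_sum => U _; rewrite sum1dep_card; apply/subset_leq_card/subsetP => i.
  by rewrite !inE => /andP[/andP[iA _] /eqP <-]; rewrite iA fragment_sub.
have step2 (U : {set X}) : #|[set c | agree_on Q c0 c & U \in big c]| <=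
    #|C| ^ #|U| * #|[set c | agree_on Q c0 c & host c U]|.
  set S := [set c | _ & U \in _]; set S' := [set c | _ & host c U].
  (* The sets [T i] avoid the classes of [Q], so recolouring inside them respects the
     conditioning. *)
  have sub : [set recolor a U c | c in S] \subset S'.
    apply/subsetP => _ /imsetP[c + ->]; rewrite !inE => /andP[/agree_onP hc].
    case/imsetP => i; rewrite inE => /andP[iA yi] Ueq.
    have [j hj hj2] := fragment_sub_mono_member T a c iA.
    rewrite /host Ueq /fr hj hj2 andbT; apply/agree_onP => x; rewrite ffunE.
    case: ifP => // xU; right; split=> //; apply: (TQ i x iA).
    by move: xU; apply/subsetP/fragment_sub.
  rewrite -[X in X <= _]sum1_card (partition_big (recolor a U) (mem S')) /=; last first.
    by move=> c cS; apply: (subsetP sub); apply: imset_f.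
  rewrite mulnC -sum_nat_const; apply: leq_sum => c' _.
  rewrite sum1dep_card -(card_agree_off U c'); apply/subset_leq_card/subsetP => c.
  rewrite !inE => /andP[_ /eqP <-]; apply/forallP => x; apply/implyP => /negPf xU.
  by rewrite ffunE xU.
have hostk c : \sum_(U : {set X} | host c U) 1 <= 2 ^ k.
  rewrite /host; case: (mono_member _ _ _ _) => [i|]; last by rewrite big_pred0.
  case iA: (i \in A); last by rewrite big_pred0.
  rewrite sum1dep_card; apply: leq_trans (_ : #|powerset (T i)| <= _).
    by apply/subset_leq_card/subsetP => U; rewrite !inE.
  by rewrite card_powerset leq_pexp2l // Tk.
apply: leq_trans (_ : (\sum_(c | agree_on Q c0 c) \sum_(U in big c)
    #|[set i in A | U \subset T i]|) * b <= _).
  by rewrite leq_mul2r leq_sum ?orbT // => c _; apply: step1.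
rewrite (exchange_big_dep xpredT) //=.
apply: leq_trans (_ : \sum_(U : {set X}) K * #|[set c | agree_on Q c0 c & host c U]| <= _).
  rewrite big_distrl /=; apply: leq_sum => U _.
  rewrite sum_nat_const.
  case: (leqP y #|U|) => yU; last first.
    rewrite eq_card0 ?mul0n // => c; rewrite !inE; apply/negbTE/negP => /andP[_].
    case/imsetP => i; rewrite inE => /andP[_ yi] Ueq.
    by move: yU; rewrite Ueq ltnNge yi.
  have := step2 U; rewrite cardsE => /(leq_mul (leqnn (#|[set i in A | U \subset T i]| * b))).
  move=> h; apply: leq_trans (leq_trans h _); first by rewrite mulnAC mulnC mulnA mulnAC.
  by rewrite mulnA leq_mul2r [X in X <= _]mulnAC hB ?orbT.
rewrite -big_distrr leq_mul2l /=; apply/orP; right.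
under eq_bigr do rewrite -sum1dep_card.
rewrite (exchange_big_dep (agree_on Q c0)) /=; last by move=> U c _ /andP[].
rewrite mulnC -sum_nat_const; under [X in _ <= X]eq_bigl do rewrite inE.
apply: leq_sum => c cQ; apply: leq_trans (hostk c).
by under eq_bigl do rewrite cQ.
Qed.

(** For [y = 2^j]: a quarter of the spreadness gain [(16 * kap)^y] pays for the [2^(2y-1)] subsets
    of a member and for the factor [2 * kap * y] of Markov's inequality. *)
Lemma pow_halving_bound (kap y : nat) : 0 < kap -> 0 < y ->
  4 * (kap * (2 * y) * 2 ^ (2 * y).-1) <= (16 * kap) ^ y.
Proof.
move=> kap0 y0.
have e : 2 * 2 ^ (2 * y).-1 = 4 ^ y by rewrite -expnS prednK ?muln_gt0 // expnM.
have -> : 4 * (kap * (2 * y) * 2 ^ (2 * y).-1) = kap * (4 * y) * 4 ^ y by rewrite -e; lia.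
have -> : 16 = 4 * 4 by [].
have h1 : kap <= kap ^ y by rewrite -[X in X <= _]expn1 leq_pexp2l.
have h2 : 4 * y <= 4 ^ y by case: y y0 {e h1} => // y _; elim: y => // y IH; rewrite expnS; lia.
rewrite !expnMn; apply: leq_trans (leq_mul (leq_mul h1 h2) (leqnn (4 ^ y))) _.
by rewrite -mulnA mulnC.
Qed.

(* The probability that no T i is coloured by cs, conditioned on the classes of the colours in Q.
   Each colour of cs halves the bound 2^j on the sizes with conditional probability at least 3/4,
   and p(m, j) <= p(m-1, j)/4 + p(m-1, j-1) yields p(m, j) <= 4^j / 2^m. *)
Lemma spread_coloring (R K kap : nat) (cs : seq C) :
  0 < kap -> uniq cs -> 16 * kap * #|C| <= R ->
  forall j Q c0 A T,
  (forall a, a \in cs -> a \notin Q) ->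
  (forall i x, i \in A -> x \in T i -> c0 x \notin Q) ->
  (forall i, i \in A -> #|T i| < 2 ^ j) ->
  (forall B : {set X}, #|[set i in A | B \subset T i]| * R ^ #|B| <= K) ->
  K * (2 ^ j - 1) < kap * #|A| * 2 ^ j ->
  #|[set c | agree_on Q c0 c &
      [forall i in A, ~~ (T i \subset [set x | c x \in cs])]]| * 2 ^ size cs
    <= 4 ^ j * #|[set c | agree_on Q c0 c]|.
Proof.
move=> kap0 + hR; elim: cs => [|a cs IH] /=.
  move=> _ j Q c0 A T _ _ _ _ _; rewrite muln1.
  apply: leq_trans (leq_pmull _ _); last by rewrite expn_gt0.
  by apply/subset_leq_card/subsetP => c; rewrite !inE => /andP[].
case/andP=> acs /IH {}IH j Q c0 A T csQ TQ Tj hB hA.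
have aQ : a \notin Q by apply: csQ; rewrite mem_head.
have K0 : 0 < K.
  have := hB set0; rewrite cards0 muln1.
  have -> : [set i in A | set0 \subset T i] = A by apply/setP => i; rewrite inE sub0set andbT.
  by case: (K) hA => //; rewrite mul0n leqn0 => + /eqP e; rewrite e muln0.
case: j Tj hA => [|j] Tj hA.
  (* At [j = 0] every [T i] is empty and [hA] makes [A] nonempty, so no colouring fails. *)
  have [i iA] : exists i, i \in A.
    by apply/set0Pn; rewrite -card_gt0; move: hA; rewrite !muln1 muln0 muln_gt0 kap0.
  rewrite (_ : [set c | _ & _] = set0) ?cards0 ?mul0n //.
  apply/setP => c; rewrite !inE; apply/negbTE/negP => /andP[_ /forall_inP/(_ i iA)].
  by have := Tj i iA; rewrite ltnS leqn0 cards_eq0 => /eqP ->; rewrite sub0set.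
set cls := [set c | agree_on Q c0 c].
set bad := [set c | _ & _].
pose fr W i := fragment A T W i.
pose lost W := [set i in A | 2 ^ j <= #|fr W i|].
(* A good class loses at most [K / (kap * 2^j.+1)] members, exactly what turns the bound [hA] for
   [j.+1] into the one for [j]. *)
pose good W := kap * 2 ^ j.+1 * #|lost W| <= K.
have csQ' a' : a' \in cs -> a' \notin a |: Q.
  move=> h; rewrite in_setU1 negb_or csQ ?in_cons ?h ?orbT // andbT.
  by apply: contraNneq acs => <-.
have key W : #|[set c in bad | color_class a c == W]| * 2 ^ size cs <=
    (if good W then 4 ^ j else 4 ^ j.+1) * #|[set c in cls | color_class a c == W]|.
  case: (set_0Vmem [set c in bad | color_class a c == W]) => [->|[c1]].
    by rewrite cards0.
  rewrite !inE => /andP[/andP[c1Q _] /eqP c1W].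
  have clsE : [set c in cls | color_class a c == W] = [set c | agree_on (a |: Q) c1 c].
    by apply/setP => c; rewrite !inE (agree_on_class c aQ c1Q) c1W.
  have c1nQ i x : i \in A -> x \in T i -> c1 x \notin Q.
    by move=> iA xT; case/agree_onP/(_ x): c1Q => [->|[]//]; apply: TQ xT.
  (* The induction hypothesis once the class [W] of [a] is revealed: as some [T k] lies in
     [W :|: T' i], a set [T' i] coloured by [cs] yields a [T k] coloured by [a :: cs]. *)
  have fin A' T' j' :
      (forall i x, i \in A' -> x \in T' i -> x \notin W) ->
      (forall i, i \in A' -> (i \in A) && (T' i \subset T i)) ->
      (forall i, i \in A' -> exists2 k, k \in A & T k \subset W :|: T' i) ->
      (forall i, i \in A' -> #|T' i| < 2 ^ j') ->
      K * (2 ^ j' - 1) < kap * #|A'| * 2 ^ j' ->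
      #|[set c in bad | color_class a c == W]| * 2 ^ size cs <=
      4 ^ j' * #|[set c in cls | color_class a c == W]|.
    move=> hW hAA hex hj hA'; rewrite clsE.
    apply: leq_trans (IH j' (a |: Q) c1 A' T' csQ' _ hj _ hA').
    - rewrite leq_mul2r; apply/orP; right; apply/subset_leq_card/subsetP => c.
      rewrite !inE (agree_on_class c aQ c1Q) c1W => /andP[/andP[-> hbad] cW].
      rewrite cW /=; apply/forall_inP => i iA'; have [k kA kT] := hex i iA'.
      apply: contra (forall_inP hbad k kA) => hT; apply/subsetP => x xk.
      rewrite inE in_cons; have := subsetP kT x xk; rewrite inE -(eqP cW) inE.
      by case/orP => [->//|/(subsetP hT)]; rewrite inE => ->; rewrite orbT.
    - move=> i x iA' xT; have /andP[iA /subsetP sT] := hAA i iA'.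
      rewrite in_setU1 negb_or (c1nQ i x iA (sT x xT)) andbT.
      by have := hW i x iA' xT; rewrite -c1W inE.
    - move=> B; apply: leq_trans (hB B); rewrite leq_mul2r; apply/orP; right.
      apply/subset_leq_card/subsetP => i; rewrite !inE => /andP[iA' BT].
      by have /andP[-> sT] := hAA i iA'; apply: subset_trans BT sT.
  case: ifP => gW; last first.
    (* For a class that is not good, [W] is just removed from the sets and the size bound stays at
       [j.+1]. *)
    apply: (fin A (fun i => T i :\: W)) => //.
    - by move=> i x iA; rewrite inE => /andP[].
    - by move=> i iA; rewrite iA subsetDl.
    - by move=> i iA; exists i => //; rewrite -subDset subxx.
    - by move=> i iA; apply: leq_ltn_trans (Tj i iA); rewrite subset_leq_card ?subsetDl.
  apply: (fin (A :\: lost W) (fr W)) => //.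
  - move=> i x; rewrite inE => /andP[_ /(fragmentP T W)[k [_ _ e _]]].
    by rewrite /fr e inE => /andP[].
  - by move=> i; rewrite inE => /andP[_ iA]; rewrite iA fragment_sub.
  - move=> i; rewrite inE => /andP[_ /(fragmentP T W)[k [kA _ e _]]].
    by exists k => //; rewrite /fr e -subDset.
  - by move=> i /setDP[iA]; rewrite inE iA /= -ltnNge.
  - have lA : lost W \subset A by apply/subsetP => i; rewrite inE => /andP[].
    move: hA gW; rewrite /good cardsD (setIidPr lA); have := subset_leq_card lA.
    rewrite expnS; have : 0 < 2 ^ j by rewrite expn_gt0.
    move: #|lost W| #|A| (2 ^ j) => l u v v0 lu hA gW.
    rewrite -{hA gW}[v]prednK // in hA gW *; move: v.-1 hA gW => {v0}v hA gW.
    rewrite -(subnK lu) in hA; move: (u - l) hA => D hA.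
    have -> : v.+1 - 1 = v by rewrite subn1.
    have e2 : 2 * v.+1 - 1 = 2 * v + 1 by lia.
    rewrite e2 in hA; nia.
have Pj : 0 < 2 ^ j by rewrite expn_gt0.
have hlost : (\sum_(c in cls) #|lost (color_class a c)|) * (16 * kap) ^ (2 ^ j) <=
    K * (2 ^ (2 ^ j.+1).-1 * #|cls|).
  under eq_bigl do rewrite inE.
  apply: sum_large_fragments => // [i iA|B yB].
    by rewrite -ltnS prednK ?expn_gt0 // Tj.
  apply: leq_trans (hB B); rewrite -mulnA leq_mul2l; apply/orP; right.
  apply: leq_trans (_ : (16 * kap * #|C|) ^ #|B| <= _); last by rewrite leq_exp2r ?(leq_trans Pj).
  rewrite [X in _ <= X]expnMn mulnC leq_mul2r.
  by rewrite leq_pexp2l ?orbT // muln_gt0.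
(* Markov's inequality: the mean number of lost members is at most a quarter of the threshold in
   [good]. *)
have hnongood : 4 * #|[set c in cls | ~~ good (color_class a c)]| <= #|cls|.
  set ng := [set c in cls | _].
  have markov : #|ng| * K <= kap * 2 ^ j.+1 * \sum_(c in cls) #|lost (color_class a c)|.
    rewrite -sum_nat_const big_distrr /= [X in _ <= X](bigID (fun c => good (color_class a c))) /=.
    apply: leq_trans (leq_addl _ _); rewrite (eq_bigl (fun c => (c \in cls) && ~~ good (color_class a c))).
      by apply: leq_sum => c /andP[_]; rewrite /good -ltnNge => /ltnW.
    by move=> c; rewrite inE.
  rewrite -(leq_pmul2r K0).
  have p0 : 0 < (16 * kap) ^ (2 ^ j) by rewrite expn_gt0 muln_gt0 kap0.
  rewrite -(leq_pmul2r p0).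
  have := pow_halving_bound kap0 Pj; rewrite -expnS => hp.
  move: hlost markov hp; set S := \sum_(c in cls) _.
  move: (2 ^ j.+1) ((16 * kap) ^ (2 ^ j)) (2 ^ (2 ^ j.+1).-1) #|cls| #|ng| => r p q cl g h1 h2 h3.
  apply: leq_trans (_ : 4 * (kap * r * S) * p <= _).
    by rewrite leq_mul2r -[X in (X <= _)]mulnA leq_mul2l h2 !orbT.
  apply: leq_trans (_ : 4 * (kap * r) * (K * (q * cl)) <= _).
    have -> : 4 * (kap * r * S) * p = 4 * (kap * r) * (S * p) by rewrite !mulnA.
    by rewrite leq_mul2l h1 orbT.
  have -> : 4 * (kap * r) * (K * (q * cl)) = 4 * (kap * r * q) * (K * cl) by nia.
  by rewrite [cl * K]mulnC [X in _ <= X]mulnC leq_mul2r h3 orbT.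
have split (S : {set {ffun X -> C}}) : #|S| = \sum_W #|[set c in S | color_class a c == W]|.
  rewrite -[LHS]sum1_card (partition_big (color_class a) xpredT) //=.
  by apply: eq_bigr => W _; rewrite sum1dep_card.
have total : #|bad| * 2 ^ size cs <=
    4 ^ j * #|cls| + 4 ^ j.+1 * #|[set c in cls | ~~ good (color_class a c)]|.
  rewrite (split bad) (split cls) (split [set c in cls | _]) !big_distrr big_distrl -big_split /=.
  apply: leq_sum => W _; apply: leq_trans (key W) _; case: ifP => gW; first exact: leq_addr.
  apply: leq_trans (leq_addl _ _); rewrite leq_mul2l; apply/orP; right.
  apply/subset_leq_card/subsetP => c; rewrite !inE => /andP[-> cW]; rewrite cW (eqP cW) gW.
  by [].
move: total hnongood; rewrite !expnS; set b := #|bad|.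
move: (4 ^ j) (2 ^ size cs) #|cls| => p q cl; set g := #|_|; nia.
Qed.

End Coloring.

Lemma card_bigcup_le (X J : finType) (P : pred J) (A : J -> {set X}) :
  #|\bigcup_(j | P j) A j| <= \sum_(j | P j) #|A j|.
Proof.
elim/big_rec2: _ => [|j n U _ IH]; first by rewrite cards0.
by apply: leq_trans (leq_card_setU _ _) _; rewrite leq_add2l.
Qed.

(** * Disjoint members of spread families *)

Section Matching.
Variables (X I : finType) (gr : I -> {set X}) (k m j R kap : nat).
Variables (G : 'I_k -> {set I}) (A : 'I_k -> {set X}) (K : 'I_k -> nat).
Hypothesis kap_gt0 : 0 < kap.
Hypothesis GA : forall i g, g \in G i -> A i \subset gr g.
Hypothesis grj : forall g, #|gr g| < 2 ^ j.
Hypothesis disjA : forall i i', i != i' -> [disjoint A i & A i'].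
Hypothesis Gspread : forall i (B : {set X}), [disjoint B & A i] ->
  #|[set g in G i | A i :|: B \subset gr g]| * R ^ #|B| <= K i.
Hypothesis K_gt0 : forall i, 0 < K i.
Hypothesis KG : forall i, K i <= kap * #|G i|.
Hypothesis hA : 2 * kap * (\sum_i #|A i|) <= R.
Hypothesis hR : 16 * (2 * kap) * (k * m) <= R.
Hypothesis hkm : k * 4 ^ j < 2 ^ m.

Let V i := \bigcup_(i' | i' != i) A i'.
(** Members avoiding the other kernels; disjointness then has to be forced outside the kernels
    only. *)
Let G' i := [set g in G i | [disjoint gr g & V i]].

Let VA i : [disjoint V i & A i].
Proof.
rewrite disjoint_sym; apply/bigcup_disjointP => i' ne.
by rewrite disjA // eq_sym.
Qed.

(** By spreadness each cell of [V i] lies in at most [K i / R] members of [G i], so at most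
    [K i / (2 * kap)] members meet [V i], half of what [KG] guarantees. *)
Let KG' i : K i <= 2 * kap * #|G' i|.
Proof.
have vR : 2 * kap * #|V i| <= R.
  apply: leq_trans hA; rewrite leq_mul2l; apply/orP; right.
  apply: leq_trans (card_bigcup_le _ _) _.
  by rewrite [X in _ <= X](bigID (fun i' => i' != i)) leq_addr.
have R0 : 0 < R.
  apply: leq_trans hR; rewrite !muln_gt0 kap_gt0 (leq_trans _ (ltn_ord i)) //=.
  move: hkm; case: (m) => // /ltn_geF; rewrite muln_gt0 expn_gt0 /= andbT.
  by rewrite (leq_trans _ (ltn_ord i)).
have rem : #|G i :\: G' i| * R <= #|V i| * K i.
  apply: leq_trans (_ : (\sum_(x in V i)
      #|[set g in G i | A i :|: [set x] \subset gr g]|) * R <= _).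
    rewrite leq_mul2r; apply/orP; right.
    apply: leq_trans (card_bigcup_le _ _); apply/subset_leq_card/subsetP => g.
    rewrite !inE => /andP[+ gG]; rewrite gG /= -setI_eq0 => /set0Pn[x].
    rewrite inE => /andP[xg xV]; apply/bigcupP; exists x => //.
    by rewrite inE gG subUset GA //= sub1set.
  rewrite -sum_nat_const big_distrl /=; apply: leq_sum => x xV.
  have := @Gspread i [set x]; rewrite cards1 expn1; apply.
  by rewrite disjoints1; have /disjointFr -> := VA i.
have sG : G' i \subset G i by apply/subsetP => g; rewrite inE => /andP[].
have := KG i; have := K_gt0 i; have := cardsD (G i) (G' i); rewrite (setIidPr sG).
have := subset_leq_card sG; move: vR rem.
move: #|G i| #|G' i| #|V i| (K i) #|_ :\: _| => g g' v K0 d vR rem gg e K00 hK.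
have : v = 0 \/ 0 < v by case: (v) => [|?]; [left|right].
case=> [v0|v0].
  have : d * R = 0 by move: rem; rewrite v0; case: (d * R).
  nia.
have : d * (2 * kap) <= K0.
  rewrite -(leq_pmul2r v0); apply: leq_trans (_ : d * R <= _); first by nia.
  by rewrite mulnC in rem *; nia.
nia.
Qed.
(** Colours are pairs in ['I_k * 'I_m], the block of [i] being its [m] colours. Each family fails
    with probability at most [4^j / 2^m], so by [hkm] and a union bound some colouring suits all
    families at once. *)
Lemma spread_matching : exists g : 'I_k -> I,
  (forall i, g i \in G i) /\ (forall i i', i != i' -> [disjoint gr (g i) & gr (g i')]).
Proof.
case: (posnP k) => [k0|k_gt0].
  have empty (i : 'I_k) : False by case: i => i; rewrite k0.
  by exists (fun i => False_rect I (empty i)); split=> i; case: (empty i).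
pose cs (i : 'I_k) : seq ('I_k * 'I_m) := [seq (i, r) | r <- enum 'I_m].
have csE i r i' : ((i', r) \in cs i) = (i' == i).
  apply/mapP/eqP => [[r' _ [-> _]]//|->]; by exists r; rewrite ?mem_enum.
suff [c hc] : exists c : {ffun X -> 'I_k * 'I_m}, forall i,
    exists g, (g \in G' i) && (gr g :\: A i \subset [set x | c x \in cs i]).
  have [g hg] := fin_all_exists hc; exists g; split=> [i|i i' ne].
    by have /andP[+ _] := hg i; rewrite inE => /andP[].
  (* By the choice of [G'], a common cell lies outside both kernels, so its colour would belong to
     both blocks. *)
  rewrite -setI_eq0; apply/eqP/setP => x; rewrite inE in_set0; apply/negbTE/negP => /andP[xi xi'].
  have out (l l' : 'I_k) : l != l' -> x \in gr (g l) -> x \notin A l'.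
    move=> nl xl; have /andP[+ _] := hg l; rewrite inE => /andP[_ /disjointFr/(_ xl)/negbT].
    by apply: contra => xA; apply/bigcupP; exists l' => //; rewrite eq_sym.
  have hcol l : x \in gr (g l) -> x \notin A l -> (c x).1 == l.
    move=> xl xA; have /andP[_ /subsetP/(_ x)] := hg l.
    by rewrite !inE xA xl => /(_ isT); case: (c x) => u v; rewrite csE.
  have ne' : i' != i by rewrite eq_sym.
  move: (ne); by rewrite -(eqP (hcol i xi (out _ _ ne' xi'))) (eqP (hcol i' xi' (out _ _ ne xi))) eqxx.
have m_gt0 : 0 < m.
  by case: (m) hkm => //; rewrite ltnS leqn0 muln_eq0 expn_eq0 eqn0Ngt k_gt0.
(* Any [c0] serves: conditioning on the empty set of colours leaves all colourings. *)
pose c0 : {ffun X -> 'I_k * 'I_m} := [ffun=> (Ordinal k_gt0, Ordinal m_gt0)].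
pose all := [set c | agree_on set0 c0 c].
pose fail i := [set c | agree_on set0 c0 c &
    [forall g in G' i, ~~ (gr g :\: A i \subset [set x | c x \in cs i])]].
have all_gt0 : 0 < #|all|.
  by apply/card_gt0P; exists c0; rewrite inE; apply/agree_onP; left.
have hfail i : #|fail i| * 2 ^ m <= 4 ^ j * #|all|.
  have szcs : size (cs i) = m by rewrite size_map -cardE card_ord.
  rewrite -[in 2 ^ m]szcs; apply: (@spread_coloring _ _ _ R (K i) (2 * kap)).
  - by rewrite muln_gt0.
  - by rewrite map_inj_uniq ?enum_uniq // => r r' [].
  - by rewrite card_prod !card_ord.
  - by move=> a _; rewrite inE.
  - by move=> g x _ _; rewrite inE.
  - by move=> g _; apply: leq_ltn_trans (grj g); rewrite subset_leq_card ?subsetDl.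
  - move=> B; case: (boolP [disjoint B & A i]) => dB.
      apply: leq_trans (Gspread dB); rewrite leq_mul2r; apply/orP; right.
      apply/subset_leq_card/subsetP => g; rewrite !inE => /andP[/andP[gG _] BT].
      by rewrite gG subUset GA //= (subset_trans BT) ?subsetDl.
    rewrite (_ : [set g in G' i | _] = set0) ?cards0 //.
    apply/setP => g; rewrite !inE; apply/negbTE; apply: contra dB => /andP[_ BT].
    rewrite disjoint_subset; apply/subsetP => x /(subsetP BT).
    by rewrite !inE => /andP[].
  - have := KG' i; have := K_gt0 i; have : 0 < 2 ^ j by rewrite expn_gt0.
    move: (2 ^ j) (K i) (2 * kap * _) => p q r; nia.
have lt : \sum_i #|fail i| < #|all|.
  have p0 : 0 < 2 ^ m by rewrite expn_gt0.
  rewrite -(ltn_pmul2r p0) big_distrl /=.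
  apply: leq_ltn_trans (_ : \sum_(i < k) 4 ^ j * #|all| < _); first exact: leq_sum.
  by rewrite sum_nat_const card_ord mulnA [#|all| * _]mulnC ltn_pmul2r.
have /subsetPn[c call cfail] : ~~ (all \subset \bigcup_i fail i).
  apply/negP => /subset_leq_card h; move: lt; rewrite ltnNge => /negP; apply.
  by apply: leq_trans h (card_bigcup_le _ _).
exists c => i; apply/existsP; apply: contraR cfail => /existsPn h.
apply/bigcupP; exists i => //; rewrite inE; move: call; rewrite inE => -> /=.
by apply/forall_inP => g gG; have := h g; rewrite gG.
Qed.
End Matching.

(** * Permutations as sets of cells *)

(** [R^R] is at most the falling factorial of [2R] of length [R], which is [R!] times the central
    binomial coefficient, itself at most [4^R]. *)
Lemma expn_self_le_fact R : R ^ R <= R`! * 4 ^ R.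
Proof.
have h : R ^ R <= (R + R) ^_ R.
  rewrite ffact_prod -{2}[R]card_ord -prod_nat_const.
  by apply: leq_prod => i _; have := ltn_ord i; lia.
apply: leq_trans h _; rewrite -bin_ffact mulnC leq_mul2l; apply/orP; right.
rewrite -[4]/(2 ^ 2) -expnM mul2n -addnn.
have := Pascal 1 1 (R + R); rewrite addn1 => ->.
by rewrite (bigD1 (inord R)) //= inordK ?exp1n ?muln1 ?leq_addr // ltnS leq_addr.
Qed.

(** Spreadness of the whole symmetric group. As long as [b + R <= N], each factor dropped from [N!]
    is at least [R]. Beyond that, [(N - b)! <= R^(N - b)], and [R^N <= N!] follows from [4 * R <= N]
    and [N^N <= N! * 4^N]. *)
Lemma expn_fact_le R N b : 4 * R <= N -> b <= N -> R ^ b * (N - b)`! <= N`!.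
Proof.
move=> RN bN; case: (leqP (b + R) N) => bR.
  elim: b bN bR => [|b IH] bN bR; first by rewrite mul1n subn0.
  apply: leq_trans (IH (ltnW bN) (ltnW bR)).
  rewrite expnSr -mulnA leq_mul2l; apply/orP; right.
  have -> : N - b = (N - b.+1).+1 by lia.
  by rewrite factS leq_mul2r; apply/orP; right; lia.
have fact_le m : m <= R -> m`! <= R ^ m.
  elim: m => // m IH mR; rewrite factS expnS leq_mul //; exact/IH/ltnW.
apply: leq_trans (_ : R ^ N <= _).
  rewrite -[in X in _ <= X](subnKC bN) expnD leq_mul2l fact_le ?orbT //; lia.
have p4 : 0 < 4 ^ N by rewrite expn_gt0.
rewrite -(leq_pmul2r p4); apply: leq_trans (expn_self_le_fact N).
rewrite -expnMn mulnC; case: N RN {bN bR p4 fact_le} => // N RN; by rewrite leq_exp2r.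
Qed.

Section Graphs.
Variable n : nat.
Local Notation perm_n := {perm 'I_n}.
Implicit Types (g h p q : perm_n) (B : {set 'I_n * 'I_n}).

Definition graph g : {set 'I_n * 'I_n} := [set xy | g xy.1 == xy.2].

Definition above B : {set perm_n} := [set g | B \subset graph g].

Lemma in_graph g x y : ((x, y) \in graph g) = (g x == y). Proof. by rewrite inE. Qed.

Lemma card_graph g : #|graph g| = n.
Proof.
have -> : graph g = [set (x, g x) | x in 'I_n].
  apply/setP => -[x y]; rewrite in_graph; apply/eqP/imsetP => [<-|[z _ [-> ->]]//].
  by exists x.
by rewrite card_imset ?card_ord // => x y [].
Qed.

Lemma intersectingE p q : intersecting p q = ~~ [disjoint graph p & graph q].
Proof.
rewrite -setI_eq0; apply/existsP/set0Pn => [[x /eqP e]|[[x y]]].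
  by exists (x, p x); rewrite !inE /= e eqxx.
by rewrite !inE /= => /andP[/eqP <- /eqP e]; exists x; rewrite e.
Qed.

Lemma intersecting_sym p q : intersecting p q = intersecting q p.
Proof. by rewrite !intersectingE disjoint_sym. Qed.

Lemma intersecting_refl p : 0 < n -> intersecting p p.
Proof. by move=> n0; apply/existsP; exists (Ordinal n0). Qed.

(** Composition with the inverse of [g] turns the permutations above [B] into those fixing every row
    of [B]. *)
Lemma card_above B g : g \in above B -> #|above B| = (n - #|B|)`!.
Proof.
rewrite inE => Bg; pose rows := [set xy.1 | xy in B].
have crows : #|rows| = #|B|.
  apply: card_in_imset => -[x y] [x' y'] /(subsetP Bg) + /(subsetP Bg).
  by rewrite !in_graph /= => /eqP <- /eqP <- ->.
have -> : above B = [set (h * g)%g | h in perm_on (~: rows)].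
  apply/setP => f; rewrite inE; apply/subsetP/imsetP => [Bf|[h hB ->] [x y] xyB].
    exists (f * g^-1)%g; last by rewrite mulgKV.
    apply/subsetP => x; rewrite inE in_setC; apply: contra => /imsetP[[u v] uvB ->] /=.
    have /eqP fu : f u == v by rewrite -in_graph Bf.
    have /eqP gu : g u == v by rewrite -in_graph (subsetP Bg).
    by rewrite permM fu -gu permK.
  rewrite in_graph permM (out_perm hB) -?in_graph ?(subsetP Bg) //.
  by rewrite inE negbK; apply/imsetP; exists (x, y).
rewrite card_imset; last exact: mulIg.
by rewrite card_perm cardsCs setCK card_ord crows.
Qed.

Lemma card_above_le B : #|above B| <= (n - #|B|)`!.
Proof.
case: (set_0Vmem (above B)) => [->|[g /card_above -> //]].
by rewrite cards0.
Qed.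

Lemma perm_ex2 (x u y v : 'I_n) : x != u -> y != v -> exists g, g x = y /\ g u = v.
Proof.
move=> xu yv; exists (tperm x y * tperm (tperm x y u) v)%g; rewrite !permM tpermL.
split; last by rewrite tpermL.
apply: tpermD; last by rewrite eq_sym.
by rewrite -[X in _ != X](tpermL x y) (inj_eq perm_inj) eq_sym.
Qed.

Lemma card_above1 x : #|above [set x]| = (n.-1)`!.
Proof.
case: x => x y; rewrite (@card_above _ (tperm x y)) ?cards1 ?subn1 //.
by rewrite inE sub1set in_graph tpermL.
Qed.

Lemma card_above2 (x u y v : 'I_n) : x != u -> y != v ->
  #|above [set (x, y); (u, v)]| = (n - 2)`!.
Proof.
move=> xu yv; have [g [gx gu]] := perm_ex2 xu yv.
rewrite (@card_above _ g) ?cards2 ?xpair_eqE ?negb_and ?xu //.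
by rewrite inE subUset !sub1set !in_graph gx gu !eqxx.
Qed.

End Graphs.

(** * Switching: permutations avoiding two given ones *)

Section Switching.
Variables (n : nat) (p q : {perm 'I_n}) (B : {set 'I_n * 'I_n}).
Hypothesis Bp : [disjoint B & graph p].
Hypothesis Bq : [disjoint B & graph q].
Hypothesis B2 : #|B| <= 2.
Local Notation perm_n := {perm 'I_n}.

Let hits (g : perm_n) := [set x | (g x == p x) || (g x == q x)].
Let lev k := [set g in above B | #|hits g| == k].
Let rows := [set xy.1 | xy in B].

(** Positions [x2] such that exchanging the values of [g] at [x1] and [x2] removes the hit [x1],
    creates no new hit and keeps the cells of [B]. *)
Let good (g : perm_n) x1 := ~: (hits g :|: rows :|:
  [set g^-1%g (p x1); g^-1%g (q x1); p^-1%g (g x1); q^-1%g (g x1)]).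

Let card_good g x1 : n <= #|good g x1| + (#|hits g| + 6).
Proof.
rewrite -[X in X <= _]card_ord -(cardsC (hits g :|: rows :|:
  [set g^-1%g (p x1); g^-1%g (q x1); p^-1%g (g x1); q^-1%g (g x1)])) -/(good g x1).
rewrite addnC leq_add2l; apply: leq_trans (leq_card_setU _ _) _.
have -> : 6 = 2 + 4 by [].
rewrite addnA; apply: leq_add.
  apply: leq_trans (leq_card_setU _ _) _; rewrite leq_add2l.
  by apply: leq_trans (leq_imset_card _ _) B2.
rewrite !cardsU !cards1; lia.
Qed.

Let x1_of (g : perm_n) x2 := odflt x2 [pick x in hits g].

(** Each [g] with [k.+1] hits has at least [n - (k + 7)] switchings that destroy one chosen hit
    [x1]. The result, together with [x1] and the bit telling whether [g x1] is [p x1] or [q x1],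
    determines [g x1], hence [x2] and [g]: this accounts for the [n * 2]. *)
Let lev_step k : #|lev k.+1| * (n - (k + 7)) <= #|lev k| * (n * 2).
Proof.
pose P := [set gx : perm_n * 'I_n | (gx.1 \in lev k.+1) && (gx.2 \in good gx.1 (x1_of gx.1 gx.2))].
have cardP : #|lev k.+1| * (n - (k + 7)) <= #|P|.
  rewrite -sum_nat_const -sum1dep_card -(pair_big_dep (fun g => g \in lev k.+1)
     (fun g x => x \in good g (x1_of g x)) (fun _ _ => 1)) /=.
  apply: leq_sum => g; rewrite inE => /andP[_ /eqP hk].
  have [x1 x1h] : exists x1, x1 \in hits g by apply/card_gt0P; rewrite hk.
  rewrite (eq_bigl (mem (good g (x1_of g x1)))); last first.
    by move=> x /=; rewrite /x1_of; case: pickP => [//|/(_ x1)]; rewrite x1h.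
  by rewrite sum1_card; have := card_good g (x1_of g x1); rewrite hk; lia.
apply: leq_trans cardP _.
pose f (gx : perm_n * 'I_n) := let x1 := x1_of gx.1 gx.2 in
  ((tperm x1 gx.2 * gx.1)%g, (x1, gx.1 x1 == p x1)).
have -> : #|lev k| * (n * 2) = #|setX (lev k) [set: 'I_n * bool]|.
  by rewrite cardsX cardsT card_prod card_ord card_bool.
have x1P g x2 : g \in lev k.+1 -> x1_of g x2 \in hits g.
  rewrite inE => /andP[_ /eqP hk]; rewrite /x1_of; case: pickP => [//|none].
  have /card_gt0P[x] : 0 < #|hits g| by rewrite hk.
  by rewrite none.
have finj : {in P &, injective f}.
  move=> [g x2] [g' x2']; rewrite [(g, x2) \in P]inE [(g', x2') \in P]inE /=.
  move=> /andP[/(x1P _ x2) h1 _] /andP[/(x1P _ x2') h2 _].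
  rewrite /f /=; set x1 := x1_of g x2 in h1 *; set x1' := x1_of g' x2' in h2 *.
  case=> eg ex eb; rewrite -{x1'}ex in eg eb h2 *.
  have e1 : g x1 = g' x1.
    move: h1 h2; rewrite !inE -eb; case: eqP => [e _ _|_ /= /eqP -> /eqP -> //].
    by move: eb; rewrite e eqxx => /esym/eqP.
  have ex2 : x2 = x2'.
    have := congr1 (fun h : perm_n => h^-1%g (g x1)) eg.
    by rewrite /= !invMg !tpermV !permM permK e1 permK !tpermL.
  by rewrite ex2 in eg *; move/mulgI: eg => ->.
rewrite -(card_in_imset finj); apply/subset_leq_card/subsetP => _ /imsetP[[g x2] + ->].
rewrite inE /= => /andP[gl]; have := x1P g x2 gl; rewrite /f /=; set x1 := x1_of g x2 => x1h.
rewrite !in_setC !in_setU ![_ \in [set _]]inE !negb_or.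
case/and3P=> /andP[nh nr] /andP[/andP[n1 n2] n3] n4.
move: gl; rewrite inE => /andP[Bg /eqP hk]; set g' := (tperm x1 x2 * g)%g.
have g1 : g' x1 = g x2 by rewrite permM tpermL.
have g2 : g' x2 = g x1 by rewrite permM tpermR.
have g3 x : x != x1 -> x != x2 -> g' x = g x by move=> *; rewrite permM tpermD // eq_sym.
have gV (h : perm_n) y : (x2 != h^-1%g y) = (h x2 != y).
  by rewrite -[in LHS](inj_eq (@perm_inj _ h)) permKV.
rewrite !gV in n1 n2 n3 n4.
have nr1 : x1 \notin rows.
  apply/negP => /imsetP[[u v] uvB /= e]; move: x1h; rewrite inE e.
  have /eqP -> : g u == v by rewrite -in_graph; move: Bg; rewrite inE => /subsetP->.
  have /negbT := disjointFr Bp uvB; have /negbT := disjointFr Bq uvB.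
  by rewrite !in_graph ![v == _]eq_sym => /negPf-> /negPf->.
have hits' : hits g' = hits g :\ x1.
  apply/setP => x; rewrite !inE.
  case: (eqVneq x x1) => [->|ne1] /=; first by rewrite g1 (negPf n1) (negPf n2).
  case: (eqVneq x x2) => [->|ne2] /=; last by rewrite g3.
  move: nh; rewrite inE => /negPf ->.
  by rewrite g2 ![g x1 == _]eq_sym (negPf n3) (negPf n4).
rewrite in_setX in_setT andbT inE hits'; apply/andP; split; last first.
  by rewrite -eqSS -hk (cardsD1 x1 (hits g)) x1h.
rewrite inE; apply/subsetP => -[u v] uvB; rewrite in_graph g3.
- by rewrite -in_graph; move: Bg; rewrite inE => /subsetP->.
- by apply: contraNneq nr1 => <-; apply/imsetP; exists (u, v).
- by apply: contraNneq nr => <-; apply/imsetP; exists (u, v).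
Qed.

(** Markov's inequality: the cells of [p] and [q] lie outside [B], so each of these at most [2 * n]
    cells belongs to at most [(n - #|B|.+1)!] permutations above [B]. *)
Let many_hits : 4 * #|[set g in above B | 3 < #|hits g|]| <= 2 * n * (n - #|B|.+1)`!.
Proof.
apply: leq_trans (_ : \sum_(g in above B) #|hits g| <= _).
  rewrite mulnC -sum_nat_const [X in _ <= X](bigID (fun g => 3 < #|hits g|)) /=.
  apply: leq_trans (leq_addr _ _); rewrite (eq_bigl (fun g => (g \in above B) && (3 < #|hits g|))).
    by apply: leq_sum => g /andP[].
  by move=> g; rewrite inE.
have cell x y : (x, y) \notin B -> #|[set g in above B | g x == y]| <= (n - #|B|.+1)`!.
  move=> xyB; have := card_above_le ((x, y) |: B); rewrite cardsU1 xyB; apply: leq_trans.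
  apply/subset_leq_card/subsetP => g; rewrite !inE subUset sub1set in_graph => /andP[-> ->] //.
have side (r : perm_n) : [disjoint B & graph r] ->
    \sum_(x : 'I_n) #|[set g in above B | g x == r x]| <= n * (n - #|B|.+1)`!.
  move=> Br; apply: leq_trans (_ : \sum_(x : 'I_n) (n - #|B|.+1)`! <= _); last first.
    by rewrite sum_nat_const card_ord.
  apply: leq_sum => x _.
  apply: cell; apply/negP => /(disjointFr Br); by rewrite in_graph eqxx.
have swap (r : perm_n) : \sum_(g in above B) #|[set x | g x == r x]| =
    \sum_(x : 'I_n) #|[set g in above B | g x == r x]|.
  under eq_bigr do rewrite -sum1dep_card; rewrite (exchange_big_dep xpredT) //=.
  by apply: eq_bigr => x _; rewrite sum1dep_card.
apply: leq_trans (_ : \sum_(g in above B) (#|[set x | g x == p x]| + #|[set x | g x == q x]|) <= _).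
  apply: leq_sum => g _; apply: leq_trans (leq_card_setU _ _).
  by apply/subset_leq_card/subsetP => x; rewrite !inE.
rewrite big_split /= !swap -mulnA mul2n -addnn.
by apply: leq_add; apply: side.
Qed.

(** At most 51 percent of [above B] have more than three hits, and each level is at most 2.1 times
    the one below it. So 49 percent is at most [1 + 2.1 + 2.1^2 + 2.1^3 < 16.8] times level 0, and
    42 suffices. *)
Lemma card_avoid_two : 1000 <= n -> (exists g, g \in above B) ->
  #|above B| <= 42 * #|[set g in above B | ~~ intersecting g p & ~~ intersecting g q]|.
Proof.
move=> n1000 [g0 Bg0].
have -> : [set g in above B | ~~ intersecting g p & ~~ intersecting g q] = lev 0.
  apply/setP => g; rewrite !inE; congr (_ && _); rewrite cards_eq0.
  apply/andP/eqP => [[/existsPn hp /existsPn hq]|/setP h].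
    by apply/setP => x; rewrite !inE (negPf (hp x)) (negPf (hq x)).
  by split; apply/existsPn => x; have := h x; rewrite !inE => /negbT; rewrite negb_or => /andP[].
have := many_hits; set many := [set g in above B | _] => hm.
have cover : #|above B| <= #|lev 0| + #|lev 1| + #|lev 2| + #|lev 3| + #|many|.
  apply: leq_trans (_ : #|lev 0 :|: lev 1 :|: lev 2 :|: lev 3 :|: many| <= _).
    apply/subset_leq_card/subsetP => g; rewrite !inE => -> /=.
    by case: #|hits g| => [|[|[|[|]]]].
  by do 4 (apply: leq_trans (leq_card_setU _ _) _; rewrite leq_add2r).
move: cover hm; rewrite (card_above Bg0).
have -> : n - #|B| = (n - #|B|.+1).+1 by move: B2; lia.
rewrite factS; move: (_`!) => f.
have := lev_step 0; have := lev_step 1; have := lev_step 2.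
move: #|lev 0| #|lev 1| #|lev 2| #|lev 3| #|many| B2 => a0 a1 a2 a3 am b2 h3 h2 h1 hc hm.
have e1 : 10 * a1 <= 21 * a0 by nia.
have e2 : 10 * a2 <= 21 * a1 by nia.
have e3 : 10 * a3 <= 21 * a2 by nia.
have f1 : 100 * am <= 51 * ((n - #|B|.+1).+1 * f).
  have : 100 * (2 * n) <= 4 * 51 * (n - #|B|.+1).+1 by lia.
  nia.
lia.
Qed.
End Switching.

(** * Stars and their members avoiding a permutation *)

Section Stars.
Variable n : nat.
Local Notation perm_n := {perm 'I_n}.
Local Notation cell := ('I_n * 'I_n)%type.

Definition star (c : cell) : {set perm_n} := above [set c].

Definition avoid (c : cell) (p : perm_n) : {set perm_n} :=
  [set g in star c | ~~ intersecting g p].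

Lemma in_star (g : perm_n) c : (g \in star c) = (c \in graph g).
Proof. by rewrite inE sub1set. Qed.

Lemma in_star_pair (g : perm_n) x y : (g \in star (x, y)) = (g x == y).
Proof. by rewrite in_star in_graph. Qed.

Lemma card_star c : #|star c| = (n.-1)`!.
Proof. exact: card_above1. Qed.

(** Multiplying on both sides carries [p] to the identity and the cell [c] to the cell (1, 2), as
    [al] sends [x] to 1 and [p^-1 y] to 2. *)
Lemma card_avoid c p : 1 < n -> c \notin graph p -> #|avoid c p| = d_n1 n.
Proof.
case: c => x y n1; rewrite in_graph => pxy.
pose o0 := Ordinal (ltnW n1); pose o1 := Ordinal n1.
have xu : x != p^-1%g y by rewrite -(inj_eq (@perm_inj _ p)) permKV.
have [al [alx alu]] := @perm_ex2 n x (p^-1%g y) o0 o1 xu isT.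
pose be := (al^-1 * p)%g; pose phi (g : perm_n) := (al * g * be)%g.
have phiE g z : phi g z = p (al^-1%g (g (al z))) by rewrite /phi /be !permM.
have phi_inj : injective phi by move=> g h; rewrite /phi => /mulIg/mulgI.
rewrite /d_n1 -[RHS](card_imset _ phi_inj); apply: eq_card => f; apply/idP/imsetP.
  rewrite inE in_star_pair => /andP[/eqP fx /existsPn fp].
  exists (al^-1 * f * be^-1)%g; last by rewrite /phi -!mulgA mulVg mulg1 !mulgA mulgV mul1g.
  have gE z : (al^-1 * f * be^-1)%g z = al (p^-1%g (f (al^-1%g z))).
    by rewrite /be invMg invgK !permM.
  rewrite inE; apply/andP; split; apply/forallP => z.
    rewrite gE; apply: contra (fp (al^-1%g z)) => /eqP e.
    by have := congr1 (fun u => p (al^-1%g u)) e; rewrite /= permK permKV => ->.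
  apply/implyP => z0; have -> : z = o0 by apply/val_inj/eqP.
  by rewrite gE -alx permK fx alu.
case=> g; rewrite inE => /andP[/forallP g0 /forallP g1] ->.
rewrite inE in_star_pair phiE alx; apply/andP; split.
  have -> : g o0 = o1 by apply/val_inj/eqP; have := g1 o0; rewrite /is_pt1 eqxx.
  by rewrite -alu permK permKV.
apply/existsPn => z; rewrite phiE (inj_eq perm_inj) -(inj_eq (@perm_inj _ al)) permKV.
exact: g0.
Qed.

Lemma d_n1_lower c (p : perm_n) : 1000 <= n -> c \notin graph p -> (n.-1)`! <= 42 * d_n1 n.
Proof.
move=> n1 cp; rewrite -(card_avoid _ cp); last by lia.
have dis : [disjoint [set c] & graph p] by rewrite disjoints1.
have [g gc] : exists g, g \in above [set c].
  by apply/card_gt0P; rewrite card_above1 fact_gt0.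
have := card_avoid_two dis dis; rewrite cards1 => /(_ isT n1 (ex_intro _ g gc)).
rewrite card_above1 => /leq_trans; apply; rewrite leq_mul2l; apply/orP; right.
by apply/subset_leq_card/subsetP => h; rewrite !inE => /andP[-> /andP[->]].
Qed.

(** Second moment method for the number [X] of fixed points in the star of (1, 2): the second moment
    is at most twice the first, so about half of the star has a fixed point. *)
Lemma d_n1_upper : 1000 <= n -> 4 * d_n1 n <= 3 * (n.-1)`!.
Proof.
move=> n1; have n0 : 0 < n by lia.
have n2 : 1 < n by lia.
pose o0 := Ordinal n0; pose o1 := Ordinal n2.
have cp : (o0, o1) \notin graph 1%g by rewrite in_graph perm1.
pose Z := ~: [set o0; o1].
have cZ : #|Z| = n - 2 by rewrite cardsCs setCK card_ord cards2.
rewrite -(card_avoid n2 cp).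
pose X (g : perm_n) := #|[set z in Z | g z == z]|.
pose hit := [set g in star (o0, o1) | intersecting g 1].
have split : #|avoid (o0, o1) 1| + #|hit| = (n.-1)`!.
  rewrite -(card_star (o0, o1)) -(cardsID (avoid (o0, o1) 1) (star (o0, o1))).
  congr (_ + _); apply: eq_card => g; rewrite ?in_setI ?in_setD.
    by rewrite [g \in avoid _ _]inE; case: (g \in star _).
  by rewrite [g \in avoid _ _]inE [g \in hit]inE; case: (g \in star _); rewrite /= ?andbT ?andbF ?negbK.
have S1 : \sum_(g in star (o0, o1)) X g = (n - 2) * (n - 2)`!.
  rewrite /X; under eq_bigr do rewrite -sum1dep_card.
  rewrite (exchange_big_dep (mem Z)) /=; last by move=> g z _ /andP[].
  rewrite -cZ -sum_nat_const cZ; apply: eq_bigr => z zZ.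
  have [z0 z1] : z != o0 /\ z != o1 by move: zZ; rewrite !inE negb_or => /andP.
  rewrite sum1dep_card -(@card_above2 n o0 z o1 z) 1?eq_sym //.
  by apply: eq_card => g; rewrite inE zZ /= in_star [RHS]inE subUset !sub1set !in_graph.
have S2 : \sum_(g in star (o0, o1)) X g * X g <= 2 * ((n - 2) * (n - 2)`!).
  have XX g : X g * X g = \sum_(z in Z) \sum_(z' in Z) ((g z == z) && (g z' == z')).
    rewrite /X -!sum1dep_card big_distrl big_mkcondr /=; apply: eq_bigr => z _.
    case: (g z == z) => /=; last by rewrite big1.
    by rewrite mul1n big_mkcondr /=; apply: eq_bigr => z' _; case: (_ == _).
  under eq_bigr do rewrite XX.
  rewrite exchange_big /=.
  apply: leq_trans (_ : \sum_(z in Z) 2 * (n - 2)`! <= _); last first.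
    by rewrite sum_nat_const cZ mulnCA.
  (* The term [z' = z] gives at most [(n - 2)!], the [n - 3] others at most [(n - 3)!] each. *)
  apply: leq_sum => z zZ; rewrite exchange_big /= (bigD1 z) //= mul2n -addnn.
  have [z0 z1] : z != o0 /\ z != o1 by move: zZ; rewrite !inE negb_or => /andP.
  have cnt z' : \sum_(g in star (o0, o1)) ((g z == z) && (g z' == z')) =
      #|above [set (o0, o1); (z, z); (z', z')]|.
    rewrite -sum1_card big_mkcond [RHS]big_mkcond; apply: eq_bigr => g _.
    rewrite in_star [g \in above _]inE !subUset !sub1set !in_graph -andbA.
    by case: (_ == o1); case: (g z == z); case: (g z' == z').
  apply: leq_add.
    rewrite cnt; apply: leq_trans (card_above_le _) _.
    by rewrite -setUA setUid cards2 xpair_eqE negb_and eq_sym z0.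
  have nS : n - 2 = (n - 3).+1 by lia.
  apply: leq_trans (_ : \sum_(z' in Z :\ z) (n - 3)`! <= _).
    rewrite [X in X <= _](eq_bigl (mem (Z :\ z))); last by move=> z'; rewrite !inE andbC.
    apply: leq_sum => z' /setD1P[z'z z'Z]; rewrite cnt.
    have z'0 : z' != o0 by move: z'Z; rewrite !inE negb_or => /andP[].
    apply: leq_trans (card_above_le _) _.
    rewrite setUC cardsU1 cards2 !inE !xpair_eqE !negb_or !negb_and z'0 z'z.
    by rewrite [o0 == z]eq_sym z0.
  rewrite sum_nat_const; have := cardsD1 z Z; rewrite zZ cZ nS add1n => -[<-].
  by rewrite factS leq_mul2r leqnSn orbT.
(* For an integer [x >= 1], [3 * x <= 2 + x^2] because [(x - 1)(x - 2) >= 0]. *)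
have S3 : 3 * \sum_(g in star (o0, o1)) X g <=
    2 * #|hit| + \sum_(g in star (o0, o1)) X g * X g.
  rewrite -sum1dep_card !big_distrr /= big_mkcondr -big_split /=.
  apply: leq_sum => g _; case: ifP => [_|/existsPn h]; first by case: (X g) => [|[|x]]; nia.
  suff -> : X g = 0 by [].
  apply/eqP; rewrite cards_eq0; apply/eqP/setP => z; rewrite !inE.
  by have := h z; rewrite perm1 => /negPf ->; rewrite andbF.
have e1 : (n.-1)`! = (n - 2).+1 * (n - 2)`! by rewrite -factS; congr _`!; lia.
move: S3 S2 split; rewrite S1 e1; move: (_`!) #|hit| (\sum_(g in _) _) #|_| => f h S a; nia.
Qed.
End Stars.

(** * Saturated set families *)

(** The induction carries the sharper bound [N * (1 - 2^-m)] for the first [m] terms. *)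
Lemma geometric_sum (x : nat -> nat) (N m : nat) :
  (forall b, x b * 2 ^ b.+1 <= N) -> \sum_(b < m) x b <= N.
Proof.
move=> hx; suff : (\sum_(b < m) x b) * 2 ^ m + N <= N * 2 ^ m.
  have : 0 < 2 ^ m by rewrite expn_gt0.
  move: (\sum_(b < m) _) (2 ^ m) => S p; nia.
elim: m => [|m IH]; first by rewrite big_ord0 expn0; lia.
rewrite big_ord_recr /=; have := hx m; move: IH; rewrite !expnS.
move: (2 ^ m) (x m) (\sum_(b < m) _) => p u S h1 h2.
have -> : (S + u) * (2 * p) + N = 2 * (S * p + N) + u * (2 * p) - N by lia.
by lia.
Qed.

Section Saturated.
Variables (X : finType) (s q : nat).
Implicit Types (S D : {set {set X}}) (A B : {set X}).

(** The [s] members are indexed and may repeat, so the empty set alone, being disjoint from itself,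
    counts as [s] disjoint members. *)
Definition matching_free S : bool :=
  [forall A : {ffun 'I_s -> {set X}}, [forall i, A i \in S] ==>
    [exists i, exists i', (i != i') && ~~ [disjoint A i & A i']]].

Lemma matching_freeP S : reflect (forall A : 'I_s -> {set X}, (forall i, A i \in S) ->
   ~ (forall i i', i != i' -> [disjoint A i & A i'])) (matching_free S).
Proof.
apply: (iffP forallP) => [h A AS dA|h A].
  have /implyP := h [ffun i => A i]; have hA : [forall i, [ffun i => A i] i \in S].
    by apply/forallP => i; rewrite ffunE.
  by move/(_ hA)/existsP => [i /existsP[i' /andP[ne]]]; rewrite !ffunE dA.
apply/implyP => /forallP AS; apply: contraT => /existsPn hn; case: (h A AS) => i i' ne.
by have /existsPn/(_ i') := hn i; rewrite ne /= negbK.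
Qed.

Lemma matching_free_trivIset S D : matching_free S -> D \subset S -> trivIset D -> #|D| < s.
Proof.
move=> /matching_freeP hS /subsetP DS /trivIsetP tD; rewrite ltnNge; apply/negP => sD.
apply: (hS (fun i => enum_val (widen_ord sD i))) => [i|i i' ne].
  exact/DS/enum_valP.
apply: tD; try exact: enum_valP.
by rewrite (inj_eq enum_val_inj) -(inj_eq val_inj).
Qed.

Definition saturated S : Prop :=
  [/\ matching_free S, forall A, A \in S -> #|A| <= q &
      forall B, #|B| <= q -> matching_free (B |: S) -> B \in S].

Lemma saturated_exists S : matching_free S -> (forall A, A \in S -> #|A| <= q) ->
  exists2 S', saturated S' & S \subset S'.
Proof.
move=> hS Sq; pose P S := matching_free S && [forall A in S, #|A| <= q].
have PS : P S by rewrite /P hS; apply/forall_inP.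
have [S' /maxsetP[/andP[hS' /forall_inP S'q] max] sub] := maxset_exists PS.
exists S' => //; split=> // B Bq hB; rewrite -(max (B |: S')) ?setU11 ?subsetUr //.
by rewrite /P hB; apply/forall_inP => A; rewrite in_setU1 => /predU1P[->|/S'q].
Qed.

Variable S : {set {set X}}.
Hypothesis satS : saturated S.

Let S_free : forall A : 'I_s -> {set X}, (forall i, A i \in S) ->
   ~ (forall i i', i != i' -> [disjoint A i & A i']).
Proof. by case: satS => /matching_freeP. Qed.

Lemma saturated_neq0 A : A \in S -> A != set0.
Proof.
move=> AS; apply/eqP => A0; apply: (S_free (A := fun=> A)) => // i i' _.
by rewrite A0 -setI_eq0 setI0.
Qed.

(* Adding B to S creates s disjoint members, and B is one of them; V is the union of the others. *)
Lemma saturated_blocker B : B != set0 -> #|B| <= q -> B \notin S ->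
  exists V : {set X}, [/\ #|V| <= q * s, [disjoint V & B] &
    forall A, A \in S -> ~~ [disjoint A & V]].
Proof.
move=> B0 Bq; case: satS => _ Sq sat BS.
have : ~~ matching_free (B |: S) by apply: contra BS; apply: sat.
rewrite negb_forall => /existsP[C]; rewrite negb_imply => /andP[/forallP CS /existsPn hC].
have dC i i' : i != i' -> [disjoint C i & C i'].
  by move=> ne; have /existsPn/(_ i') := hC i; rewrite ne /= negbK.
have [i0 Ci0] : exists i0, C i0 = B.
  case: (pickP (fun i => C i == B)) => [i /eqP <-|none]; first by exists i.
  case: (S_free (A := C)) => // i; have := CS i; rewrite in_setU1.
  by have := none i; rewrite /= => ->.
have Cne i : i != i0 -> C i \in S.
  move=> ne; have := CS i; rewrite in_setU1 => /predU1P[CB|//].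
  have := dC _ _ ne; rewrite CB Ci0 -setI_eq0 setIid => /eqP B00.
  by rewrite B00 eqxx in B0.
exists (\bigcup_(i | i != i0) C i); split.
- apply: leq_trans (card_bigcup_le _ _) _.
  apply: leq_trans (_ : \sum_(i < s | i != i0) q <= _).
    by apply: leq_sum => i /Cne/Sq.
  rewrite sum_nat_const mulnC leq_mul2l; apply/orP; right.
  by rewrite -[X in _ <= X]card_ord max_card.
- by rewrite disjoint_sym; apply/bigcup_disjointP => i ne; rewrite -Ci0 dC // eq_sym.
move=> A AS; apply/negP => dA.
apply: (S_free (A := fun i => if i == i0 then A else C i)) => [i|i i' ne].
  by case: ifP => [_//|/negbT/Cne].
move/bigcup_disjointP in dA.
case: ifP ne => [/eqP->|/negbT n1]; case: ifP => [/eqP->|/negbT n2] ne.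
- by rewrite eqxx in ne.
- exact: dA.
- by rewrite disjoint_sym; apply: dA.
- exact: dC.
Qed.

Definition minimal_members k : {set {set X}} :=
  [set A in S | (#|A| == k) && [forall B : {set X}, (B \proper A) ==> (B \notin S)]].

Definition singletons : {set X} := [set x | [set x] \in S].

(** Branching: a minimal member properly containing [B] excludes [B \in S], and then it meets the
    blocker [V] of [B], so it contains [v |: B] for one of at most [q * s] new points [v]. After
    [k - #|B|] rounds the member is determined. *)
Lemma minimal_members_above k B : k <= q -> B != set0 ->
  #|[set A in minimal_members k | B \subset A]| <= (q * s) ^ (k - #|B|).
Proof.
move=> kq; move e: (k - #|B|) => d; elim: d B e => [|d IH] B e B0.
  apply: leq_trans (_ : #|[set B]| <= _); last by rewrite cards1.
  apply/subset_leq_card/subsetP => A; rewrite !inE => /andP[/andP[_ /andP[/eqP Ak _]] BA].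
  by rewrite eq_sym eqEcard BA Ak; move: e; lia.
case: (boolP (B \in S)) => BS.
  rewrite (_ : [set A in _ | _] = set0) ?cards0 //; apply/setP => A; rewrite !inE.
  apply/negbTE/negP => /andP[/andP[_ /andP[/eqP Ak /forallP/(_ B) hB]] BA].
  move: hB; rewrite BS implybF properE BA /= negbK => /subset_leq_card; move: e; lia.
have [V [Vqs VB hV]] : exists V : {set X}, [/\ #|V| <= q * s, [disjoint V & B] &
    forall A, A \in S -> ~~ [disjoint A & V]].
  by apply: saturated_blocker => //; move: e; lia.
apply: leq_trans (_ : \sum_(v in V) #|[set A in minimal_members k | v |: B \subset A]| <= _).
  apply: leq_trans (card_bigcup_le _ _); apply/subset_leq_card/subsetP => A.
  rewrite inE => /andP[AM BA]; have AS : A \in S by move: AM; rewrite inE => /andP[].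
  have := hV A AS; rewrite -setI_eq0 => /set0Pn[v]; rewrite inE => /andP[vA vV].
  by apply/bigcupP; exists v => //; rewrite inE AM subUset sub1set vA.
apply: leq_trans (_ : \sum_(v in V) (q * s) ^ d <= _).
  apply: leq_sum => v vV; apply: IH; last by apply/set0Pn; exists v; rewrite setU11.
  by rewrite cardsU1 (disjointFr VB vV); move: e; lia.
by rewrite sum_nat_const expnS leq_mul2r Vqs orbT.
Qed.

Lemma card_singletons : #|singletons| < s.
Proof.
have [free _ _] := satS; rewrite -(card_imset _ (@set1_inj X)).
apply: matching_free_trivIset free _ _.
  by apply/subsetP => _ /imsetP[x + ->]; rewrite inE.
apply/trivIsetP => _ _ /imsetP[x _ ->] /imsetP[y _ ->].
by rewrite (inj_eq set1_inj) disjoints1 inE.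
Qed.

(** A maximal disjoint subfamily [D] forms a matching together with the singletons, so it has at
    most [s.-1 - #|singletons|] members. Every minimal member of size [k] meets one of its at most
    [k * #|D|] points, and [minimal_members_above] bounds those through a given point. *)
Lemma card_minimal_members k : 1 < k <= q ->
  #|minimal_members k| <= k * (s.-1 - #|singletons|) * (q * s) ^ k.-1.
Proof.
case/andP=> k1 kq; have [free Sq _] := satS.
pose P D := (D \subset minimal_members k) && trivIset D.
have P0 : P set0 by rewrite /P sub0set; apply/trivIsetP => A; rewrite inE.
have [D /maxsetP[/andP[DM tD] maxD] _] := maxset_exists P0.
have DS A : A \in D -> A \in S by move/(subsetP DM); rewrite inE => /andP[].
have Dk A : A \in D -> #|A| = k by move/(subsetP DM); rewrite inE => /andP[_ /andP[/eqP]].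
pose D1 := [set [set x] | x in singletons].
have cD1 : #|D1| = #|singletons| by apply: card_imset; apply: set1_inj.
have D1S A : A \in D1 -> A \in S by case/imsetP => x; rewrite inE => ? ->.
have disjDD1 : [disjoint D1 & D].
  rewrite -setI_eq0; apply/eqP/setP => A; rewrite !inE; apply/negbTE/negP => /andP[/imsetP[x _ ->]].
  by move/Dk; rewrite cards1 => e; rewrite -e in k1.
have mem_sep A x : A \in D -> x \in singletons -> x \notin A.
  move=> AD; rewrite inE => xS; have := subsetP DM A AD; rewrite inE => /and3P[_ /eqP Ak].
  move/forallP/(_ [set x]); rewrite /= xS implybF; apply: contra => xA.
  by rewrite properEcard sub1set xA cards1 Ak.
have tDD1 : trivIset (D1 :|: D).
  apply/trivIsetP => A B; rewrite !inE => /orP[/imsetP[x xs ->]|AD] /orP[/imsetP[y ys ->]|BD].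
  - by rewrite (inj_eq set1_inj) disjoints1 inE.
  - by move=> _; rewrite disjoints1 mem_sep.
  - by move=> _; rewrite disjoint_sym disjoints1 mem_sep.
  - by move/trivIsetP: tD; apply.
have cDD1 : #|singletons| + #|D| < s.
  rewrite -cD1 -cardsUI (eqP (_ : D1 :&: D == set0)) ?setI_eq0 // cards0 addn0.
  apply: matching_free_trivIset free _ tDD1; apply/subsetP => A.
  by rewrite inE => /orP[/D1S|/DS].
have meets A : A \in minimal_members k -> ~~ [disjoint A & cover D].
  move=> AM; apply/negP => dA.
  have AS : A \in S by move: AM; rewrite inE => /andP[].
  have AD : A \notin D.
    apply/negP => AD; have : A \subset cover D by apply: bigcup_sup.
    move/setIidPl => e; move: dA; rewrite -setI_eq0 e.
    by rewrite (negPf (saturated_neq0 AS)).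
  have : A |: D = D.
    apply: maxD; last exact: subsetUr.
    rewrite /P subUset sub1set AM DM /=; apply/trivIsetP => B B'; rewrite !in_setU1.
    have sep E : E \in D -> [disjoint A & E].
      by move=> ED; apply: disjointWr dA; apply: bigcup_sup.
    case/predU1P=> [->|BD] /predU1P[->|B'D]; rewrite ?eqxx //.
    - by move=> _; apply: sep.
    - by move=> _; rewrite disjoint_sym sep.
    - by move/trivIsetP: tD; apply.
  by move/setP/(_ A); rewrite setU11 (negPf AD).
apply: leq_trans (_ : \sum_(v in cover D) #|[set A in minimal_members k | [set v] \subset A]| <= _).
  apply: leq_trans (card_bigcup_le _ _); apply/subset_leq_card/subsetP => A AM.
  have := meets A AM; rewrite -setI_eq0 => /set0Pn[v]; rewrite inE => /andP[vA vD].
  by apply/bigcupP; exists v => //; rewrite inE AM sub1set.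
apply: leq_trans (_ : \sum_(v in cover D) (q * s) ^ k.-1 <= _).
  apply: leq_sum => v _; have := @minimal_members_above k [set v] kq; rewrite cards1 subn1; apply.
  by apply/set0Pn; exists v; rewrite inE.
rewrite sum_nat_const leq_mul2r; apply/orP; right.
apply: leq_trans (_ : \sum_(A in D) #|A| <= _); first exact: leq_card_cover.
rewrite (eq_bigr (fun=> k)) => [|A /Dk //]; rewrite sum_nat_const mulnC leq_mul2l.
by apply/orP; right; move: cDD1; lia.
Qed.

Lemma minimal_subset A : A \in S -> exists2 B : {set X}, B \subset A &
  (exists2 x, x \in singletons & B = [set x]) \/
  (1 < #|B| <= q /\ B \in minimal_members #|B|).
Proof.
move=> AS; have [_ Sq _] := satS.
have [B /minsetP[BS minB] BA] := minset_exists AS.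
exists B => //; case: (leqP #|B| 1) => B1.
  left; have /card_gt0P[x xB] : 0 < #|B| by rewrite card_gt0 saturated_neq0.
  have e : B = [set x].
    by apply/eqP; rewrite eq_sym eqEcard sub1set xB cards1.
  by exists x => //; rewrite inE -e.
have {}BS : B \in S by [].
right; rewrite Sq //; split=> //; rewrite inE BS eqxx /=.
apply/forallP => E; apply/implyP => EB; apply/negP => ES.
by have e := minB E ES (proper_sub EB); rewrite e properxx in EB.
Qed.

End Saturated.

(** * Approximation by stars *)

Section Approximation.
Variables (n s lam : nat).
Hypothesis s_gt0 : 0 < s.
Hypothesis lam_gt1 : 1 < lam.
Hypothesis hn : 256 * (256 * (lam * s)) <= n.
Hypothesis hlam : n < 2 ^ lam.+1.
Local Notation perm_n := {perm 'I_n}.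
Local Notation cell := ('I_n * 'I_n)%type.

Let w_gt0 : 0 < lam * s. Proof. by rewrite muln_gt0 s_gt0 (ltnW lam_gt1). Qed.

(* 128 = 16 * 2 * 4: with 4 lam colours for each of the k families, the total failure probability
   k 4^(lam+1) / 2^(4 lam) is below 1. *)
Lemma perm_spread_matching (k kap R : nat) (G : 'I_k -> {set perm_n})
    (A : 'I_k -> {set cell}) (K : 'I_k -> nat) :
  k <= s -> 0 < kap -> 128 * kap * (lam * s) <= R ->
  (forall i, #|A i| <= lam) ->
  (forall i, G i \subset above (A i)) ->
  (forall i i', i != i' -> [disjoint A i & A i']) ->
  (forall i (B : {set cell}), [disjoint B & A i] ->
    #|[set g in G i | A i :|: B \subset graph g]| * R ^ #|B| <= K i) ->
  (forall i, 0 < K i) -> (forall i, K i <= kap * #|G i|) ->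
  exists g : 'I_k -> perm_n, (forall i, g i \in G i) /\
    (forall i i', i != i' -> [disjoint graph (g i) & graph (g i')]).
Proof.
move=> ks kap0 hR Alam GA dA spread K0 KG.
apply: (@spread_matching _ _ (@graph n) k (4 * lam) lam.+1 R kap G A K) => //.
- by move=> i g gG; have := subsetP (GA i) g gG; rewrite inE.
- by move=> g; rewrite card_graph.
- apply: leq_trans hR; apply: leq_trans (_ : 2 * kap * (lam * s) <= _).
    rewrite leq_mul2l; apply/orP; right.
    apply: leq_trans (_ : \sum_(i < k) lam <= _); first exact: leq_sum.
    by rewrite sum_nat_const card_ord mulnC leq_mul2l ks orbT.
  by rewrite !leq_mul2r /= !orbT.
- apply: leq_trans hR.
  have -> : 16 * (2 * kap) * (k * (4 * lam)) = 128 * kap * (lam * k) by lia.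
  by rewrite leq_mul2l leq_mul2l ks !orbT.
- have s4 : 4 * s < 2 ^ lam.
    move: hn hlam; rewrite expnS; have := lam_gt1; move: (2 ^ lam); nia.
  have -> : 2 ^ (4 * lam) = 2 ^ lam * 2 ^ lam * 4 ^ lam.
    by rewrite -[4 ^ _]/((2 ^ 2) ^ lam) -expnM -!expnD; congr (2 ^ _); lia.
  have p0 : 0 < 4 ^ lam by rewrite expn_gt0.
  rewrite expnS mulnA ltn_pmul2r //.
  by move: s4 ks; move: (2 ^ lam) => p; nia.
Qed.

Variable F : {set perm_n}.
Hypothesis no_matching : forall g : 'I_s -> perm_n, (forall i, g i \in F) ->
  ~ (forall i i', i != i' -> [disjoint graph (g i) & graph (g i')]).

Let R := 128 * (lam * s).

Definition spread_over (A : {set cell}) (G : {set perm_n}) : bool :=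
  [forall B : {set cell}, [disjoint B & A] ==>
    (#|[set g in G | A :|: B \subset graph g]| * R ^ #|B| <= #|G|)].

Definition kernels : {set {set cell}} := [set A : {set cell} | (#|A| <= lam) &&
  [exists G : {set perm_n}, [&& G \subset F, G != set0, G \subset above A & spread_over A G]]].

(** Spread families over [s] disjoint kernels would contain [s] disjoint members of [F]. *)
Lemma kernels_matching_free : matching_free s kernels.
Proof.
apply/matching_freeP => A hA dA.
have hG i : exists G : {set perm_n},
    [&& G \subset F, G != set0, G \subset above (A i) & spread_over (A i) G].
  by apply/existsP; have := hA i; rewrite inE => /andP[].
have [G {}hG] := fin_all_exists hG.
have [g [gG dg]] : exists g : 'I_s -> perm_n, (forall i, g i \in G i) /\
    (forall i i', i != i' -> [disjoint graph (g i) & graph (g i')]).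
  apply: (@perm_spread_matching s 1 R G A (fun i => #|G i|)) => //.
  - by move=> i; have := hA i; rewrite inE => /andP[].
  - by move=> i; have /and4P[] := hG i.
  - by move=> i B dB; have /and4P[_ _ _ /forallP/(_ B)/implyP] := hG i; apply.
  - by move=> i; rewrite card_gt0; have /and4P[] := hG i.
  - by move=> i; rewrite mul1n.
by apply: no_matching dg => i; have /and4P[/subsetP GF _ _ _] := hG i; apply: GF.
Qed.

(** Take [A] of maximal size such that [above A] contains at least the fraction [R^-#|A|] of the
    uncovered part [F']. By maximality these members are spread over [A], so [#|A| <= lam] would
    make [A] a kernel below members of [F']. Hence [#|A| > lam], and [64 * R <= n / 4] gains a
    factor 64 for each of its cells. *)
Lemma card_uncovered :
  #|F :\: \bigcup_(A in kernels) above A| * 2 ^ (6 * lam) <= n`!.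
Proof.
set F' := _ :\: _; case: (set_0Vmem F') => [->|[g0 g0F']]; first by rewrite cards0.
have F'0 : 0 < #|F'| by apply/card_gt0P; exists g0.
pose P (A : {set cell}) := #|F'| <= #|F' :&: above A| * R ^ #|A|.
have P0 : P set0.
  rewrite /P cards0 muln1 (setIidPl _) //; apply/subsetP => g _.
  by rewrite inE sub0set.
case: (@arg_maxnP _ set0 P (fun A => #|A|) P0) => A PA maxA.
have R0 : 0 < R by rewrite muln_gt0.
have GA0 : F' :&: above A != set0.
  by rewrite -card_gt0; move: (leq_trans F'0 PA); rewrite muln_gt0 => /andP[].
have sp : spread_over A (F' :&: above A).
  apply/forallP => B; apply/implyP => dB.
  case: (eqVneq B set0) => [->|B0].
    rewrite cards0 muln1 subset_leq_card //; apply/subsetP => g; rewrite inE.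
    by case/andP.
  have AB : #|A :|: B| = #|A| + #|B|.
    rewrite -cardsUI (eqP (_ : A :&: B == set0)) ?cards0 ?addn0 //.
    by rewrite setI_eq0 disjoint_sym.
  have : ~~ P (A :|: B).
    apply/negP => /maxA; rewrite AB; move: B0; rewrite -card_gt0; lia.
  rewrite /P -ltnNge AB expnD => lt.
  have RA : 0 < R ^ #|A| by rewrite expn_gt0 R0.
  rewrite -(leq_pmul2r RA); apply: leq_trans PA; apply: leq_trans (ltnW lt).
  rewrite -mulnA [R ^ #|B| * _]mulnC leq_mul2r; apply/orP; right.
  apply/subset_leq_card/subsetP => g; rewrite !inE => /andP[/andP[-> _] ->] //.
case: (leqP #|A| lam) => Alam.
  have AK : A \in kernels.
    rewrite inE Alam; apply/existsP; exists (F' :&: above A).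
    by rewrite GA0 sp subsetIr andbT /= (subset_trans (subsetIl _ _)) // subsetDl.
  have /set0Pn[g] := GA0; rewrite inE => /andP[]; rewrite inE => /andP[/negP gn _] gA.
  by case: gn; apply/bigcupP; exists A.
have An : #|A| <= n.
  have /set0Pn[g] := GA0; rewrite inE => /andP[_]; rewrite inE => /subset_leq_card.
  by rewrite card_graph.
have h64 : 4 * (64 * R) <= n by rewrite /R; move: hn; lia.
apply: leq_trans (expn_fact_le h64 An).
apply: leq_trans (_ : (n - #|A|)`! * R ^ #|A| * 2 ^ (6 * lam) <= _).
  rewrite leq_mul2r; apply/orP; right; apply: leq_trans PA _; rewrite leq_mul2r.
  apply/orP; right; apply: leq_trans (card_above_le A).
  by rewrite subset_leq_card // subsetIr.
have h : 2 ^ (6 * lam) <= 64 ^ #|A| by rewrite expnM leq_pexp2l // ltnW.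
apply: leq_trans (leq_mul (leqnn _) h) _; rewrite expnMn.
by rewrite [X in X <= _]mulnC mulnA mulnAC.
Qed.

(* The minimal members with k >= 2 cells contribute k (s-1-|P|) (lam s)^(k-1) (n-k)!,
   a geometric series because lam s is much smaller than n. *)
Lemma star_approximation : exists (P : {set cell}) (r : nat),
  [/\ #|P| < s, r * 2 ^ (6 * lam) <= n`! &
      16 * #|F :\: \bigcup_(c in P) star c| <= (s.-1 - #|P|) * (n.-1)`! + 16 * r].
Proof.
have kerq A : A \in kernels -> #|A| <= lam by rewrite inE => /andP[].
have [S satS kerS] := saturated_exists kernels_matching_free kerq.
exists (singletons S), #|F :\: \bigcup_(A in kernels) above A|; split.
- exact: card_singletons satS.
- exact: card_uncovered.
set r := F :\: \bigcup_(A in kernels) above A; set t := #|singletons S|.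
(* The index [b] stands for size [b.+2]: singletons give the stars, larger minimal members the
   [Mk]. *)
pose Mk (b : 'I_lam.-1) := \bigcup_(A in minimal_members S b.+2) above A.
have cover : F :\: \bigcup_(c in singletons S) star c \subset \bigcup_b Mk b :|: r.
  apply/subsetP => g /setDP[gF gP]; rewrite inE.
  case: (boolP (g \in r)) => [|gr]; first by rewrite orbT.
  rewrite orbF; move: gr; rewrite in_setD gF andbT negbK => /bigcupP[A AK gA].
  have [B BA] := minimal_subset satS (subsetP kerS A AK).
  have gB : g \in above B by move: gA; rewrite !inE; apply: subset_trans.
  case=> [[x xS eB]|[/andP[B1 Blam] BM]].
    by case/negP: gP; apply/bigcupP; exists x => //; rewrite /star -eB.
  have b : #|B|.-2 < lam.-1 by lia.
  apply/bigcupP; exists (Ordinal b) => //; apply/bigcupP; exists B => //=.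
  by rewrite (_ : #|B|.-2.+2 = #|B|) //; lia.
have n1 : 4 * (64 * (lam * s)) <= n.-1 by move: hn w_gt0; lia.
have cardMk (b : 'I_lam.-1) : 16 * #|Mk b| * 2 ^ b.+1 <= (s.-1 - t) * (n.-1)`!.
  have b2 : 1 < b.+2 <= lam by have := ltn_ord b; lia.
  have cM := card_minimal_members satS b2.
  have bn : b.+1 <= n.-1.
    have := ltn_ord b; move: hn; have := s_gt0; nia.
  have fact := expn_fact_le n1 bn.
  have -> : 16 * #|Mk b| * 2 ^ b.+1 = #|Mk b| * (16 * 2 ^ b.+1) by lia.
  apply: leq_trans (_ : (b.+2 * (s.-1 - t) * (lam * s) ^ b.+1 * (n.-1 - b.+1)`!) *
      (16 * 2 ^ b.+1) <= _).
    rewrite leq_mul2r; apply/orP; right.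
    apply: leq_trans (card_bigcup_le _ _) _.
    apply: leq_trans (_ : \sum_(A in minimal_members S b.+2) (n.-1 - b.+1)`! <= _).
      apply: leq_sum => A; rewrite inE => /and3P[_ /eqP Ak _].
      by apply: leq_trans (card_above_le _) _; rewrite Ak -predn_sub subnS.
    by rewrite sum_nat_const leq_mul2r cM orbT.
  (* The 64 gained per cell in [n1] pays for the size [b.+2], the factor 16 and the geometric weight
     [2^b.+1]. *)
  have e64 : b.+2 * (16 * 2 ^ b.+1) <= 64 ^ b.+1.
    elim: (b : nat) => [//|m IH]; rewrite [64 ^ _]expnS [2 ^ m.+2]expnS.
    by move: IH; move: (2 ^ _) (64 ^ _); lia.
  rewrite expnMn in fact; apply: leq_trans (_ : (s.-1 - t) * (64 ^ b.+1 *
      (lam * s) ^ b.+1 * (n.-1 - b.+1)`!) <= _); last by rewrite leq_mul2l fact orbT.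
  move: ((lam * s) ^ b.+1) (s.-1 - t) (64 ^ b.+1) e64 (_`!) => w u q6 e64 f.
  have -> : b.+2 * u * w * f * (16 * 2 ^ b.+1) = b.+2 * (16 * 2 ^ b.+1) * (u * (w * f)).
    by move: (2 ^ _) => p; lia.
  have -> : u * (q6 * w * f) = q6 * (u * (w * f)) by lia.
  by rewrite leq_mul2r e64 orbT.
apply: leq_trans (_ : 16 * (\sum_b #|Mk b| + #|r|) <= _).
  rewrite leq_mul2l /=; apply: leq_trans (subset_leq_card cover) _.
  apply: leq_trans (leq_card_setU _ _) _; rewrite leq_add2r; exact: card_bigcup_le.
rewrite mulnDr leq_add2r big_distrr /=.
pose x b := if insub b is Some b' then 16 * #|Mk b'| else 0.
rewrite (eq_bigr (fun b : 'I_lam.-1 => x b)) => [|b _]; last by rewrite /x valK.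
apply: geometric_sum => b; rewrite /x; case: insubP => [b' _ <-|_] //.
Qed.
End Approximation.

(** Turns equality in the union bound into disjointness of the sets. *)
Lemma card_bigcup_lt (X J : finType) (P : {set J}) (A : J -> {set X}) i j x :
  i \in P -> j \in P -> i != j -> x \in A i -> x \in A j ->
  #|\bigcup_(k in P) A k| < \sum_(k in P) #|A k|.
Proof.
move=> iP jP ij xi xj; rewrite (bigD1 i) //= [X in _ < X](bigD1 i) //=.
apply: leq_ltn_trans (_ : #|(A i :\ x) :|: \bigcup_(k in P | k != i) A k| < _).
  apply/subset_leq_card/subsetP => y; rewrite !inE => /orP[yi|->]; last by rewrite orbT.
  case: (eqVneq y x) => [->|ne] //=; last by rewrite yi.
  by apply/bigcupP; exists j => //; rewrite jP eq_sym.
apply: leq_ltn_trans (leq_card_setU _ _) _; rewrite (cardsD1 x (A i)) xi -addnA add1n ltnS.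
by rewrite leq_add2l card_bigcup_le.
Qed.

Section LargeStars.
Variable n : nat.
Hypothesis n_large : 1000 <= n.
Local Notation perm_n := {perm 'I_n}.
Local Notation cell := ('I_n * 'I_n)%type.

(** Permutations through [c] and a cell [(z, p z)] outside [p'] meet [p]; by switching, a 42nd of
    these [(n - 2)!] permutations avoid [p']. *)
Lemma card_avoid_diff c (p p' : perm_n) : p != p' -> c \notin graph p -> c \notin graph p' ->
  (n - 2)`! <= 42 * #|avoid c p' :\: avoid c p|.
Proof.
case: c => x y ne; rewrite !in_graph => px p'x.
have [z [zne zx zy]] : exists z, [/\ p z != p' z, z != x & p z != y].
  (* Without such a [z], [p] and [p'] agree off [x] and the preimage of [y] under [p]. Neither sends
     [x] to [y], so they take the value [y] at the same point, agree off [x], and coincide. *)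
  case: (pickP (fun z => [&& p z != p' z, z != x & p z != y])) => [z /and3P[]|none].
    by exists z.
  have agree z : z != x -> p z != y -> p z = p' z.
    by move=> zx zy; have := none z; rewrite zx zy !andbT => /negbFE/eqP.
  have e1 : p (p'^-1%g y) = y.
    apply/eqP; apply: contraT => h; have := agree (p'^-1%g y) _ h; rewrite permKV.
    move=> e; rewrite e ?eqxx // in h.
    by apply: contraNneq p'x => <-; rewrite permKV.
  have agree2 z : z != x -> p z = p' z.
    move=> zx; case: (eqVneq (p z) y) => [e|]; last exact: agree.
    have -> : z = p'^-1%g y by apply: (@perm_inj _ p); rewrite e e1.
    by rewrite e1 permKV.
  case/eqP: ne; apply/permP => z; case: (eqVneq z x) => [->|]; last exact: agree2.
  apply/eqP; apply: contraT => h.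
  have e2 := agree2 (p^-1%g (p' x)); rewrite permKV in e2.
  have wx : p^-1%g (p' x) != x by apply: contraNneq h => e; rewrite -[in p x]e permKV.
  by move/perm_inj: (e2 wx) => e; rewrite -e eqxx in wx.
have xz : x != z by rewrite eq_sym.
have yz : y != p z by rewrite eq_sym.
pose B := [set (x, y); (z, p z)].
have dB : [disjoint B & graph p'].
  rewrite -setI_eq0; apply/eqP/setP => e; rewrite in_set0; apply/negbTE/negP => /setIP[].
  case/set2P=> ->; rewrite in_graph; first by rewrite (negPf p'x).
  by rewrite eq_sym (negPf zne).
have cB := card_above2 xz yz; rewrite -/B in cB.
rewrite -cB; apply: leq_trans (card_avoid_two dB dB _ n_large _) _.
- by rewrite cards2; case: (_ != _).
- by apply/card_gt0P; rewrite cB fact_gt0.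
rewrite leq_mul2l; apply/orP; right; apply/subset_leq_card/subsetP => g.
rewrite inE => /and3P[]; rewrite inE subUset !sub1set !in_graph => /andP[gx gz] gp' _.
rewrite in_setD ![g \in avoid _ _]inE in_star_pair gx gp' /= negbK andbT.
by apply/existsP; exists z.
Qed.

(** Take [h] through both cells and swap one of its other values so that it meets [p] at a point [z]
    away from both cells. *)
Lemma perm_through_two_meeting (c c' : cell) (p : perm_n) : c.1 != c'.1 -> c.2 != c'.2 ->
  exists g, [/\ g \in star c, g \in star c' & intersecting g p].
Proof.
case: c c' => x y [x' y'] /= xx' yy'.
have [h [hx hx']] := perm_ex2 xx' yy'.
have [z] : exists z, z \notin [set x; x'; p^-1%g y; p^-1%g y'].
  apply/existsP; rewrite -negb_forall; apply/negP => /forallP all.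
  have : #|'I_n| <= #|[set x; x'; p^-1%g y; p^-1%g y']|.
    by rewrite -cardsT; apply/subset_leq_card/subsetP => z _; apply: all.
  rewrite card_ord !cardsU !cards1; move: n_large; clear; lia.
rewrite !inE !negb_or -!andbA => /and4P[zx zx' zy zy'].
have pV v : (z != p^-1%g v) = (p z != v) by rewrite -[in LHS](inj_eq (@perm_inj _ p)) permKV.
rewrite !pV in zy zy'.
exists (h * tperm (h z) (p z))%g; rewrite !in_star_pair !permM; split.
- by rewrite tpermD ?hx // -hx (inj_eq perm_inj).
- by rewrite tpermD ?hx' // -hx' (inj_eq perm_inj).
- by apply/existsP; exists z; rewrite permM tpermL.
Qed.

End LargeStars.

(** * Large families close to a union of stars *)

Section Extremal.
Variables (n s lam : nat).
Hypothesis s_gt1 : 1 < s.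
Hypothesis lam_gt10 : 10 < lam.
Hypothesis hn : 256 * (256 * (lam * s)) <= n.
Hypothesis hlam : n < 2 ^ lam.+1.
Local Notation perm_n := {perm 'I_n}.
Local Notation cell := ('I_n * 'I_n)%type.
Variable F : {set perm_n}.
Hypothesis nuF : forall D : {set perm_n}, D \subset F -> pairwise_nonint D -> #|D| < s.
Variable P : {set cell}.
Hypothesis cP : #|P| = s.-1.
Let F2 := F :\: \bigcup_(c in P) star c.
Hypothesis F2_small : #|F2| * 2 ^ (6 * lam) <= n`!.

Let n_large : 1000 <= n.
Proof. by move: hn s_gt1 lam_gt10; clear; nia. Qed.

(** Full stars are spread over their cells, and keeping a hundredth of a star costs only
    [kap = 100]. So [E] extends by one disjoint member from each star of [Q], within the bound
    [nuF]. *)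
Lemma extend_matching (E : {set perm_n}) (Q : {set cell}) :
  #|Q| <= s -> E \subset F -> pairwise_nonint E ->
  (forall c, c \in Q ->
     (n.-1)`! <= 100 * #|[set g in F :&: star c | [forall e in E, ~~ intersecting g e]]|) ->
  #|E| + #|Q| < s.
Proof.
move=> Qs EF /forall_inP Enon hG.
pose G c := [set g in F :&: star c | [forall e in E, ~~ intersecting g e]].
have n0 : 0 < n by apply: leq_trans n_large.
have [g [gG dg]] : exists g : 'I_#|Q| -> perm_n, (forall i, g i \in G (enum_val i)) /\
    (forall i i', i != i' -> [disjoint graph (g i) & graph (g i')]).
  apply: (@perm_spread_matching n s lam _ _ _ _ #|Q| 100 (128 * 100 * (lam * s)) _
     (fun i => [set enum_val i]) (fun=> (n.-1)`!)) => //.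
  - by rewrite ltnW.
  - by apply: leq_trans lam_gt10.
  - by move=> i; rewrite cards1; apply: leq_trans lam_gt10.
  - by move=> i; apply/subsetP => g; rewrite !inE => /andP[/andP[_]].
  - by move=> i i' ne; rewrite disjoints1 inE (inj_eq enum_val_inj).
  - move=> i B; rewrite disjoint_sym disjoints1 => iB.
    apply: leq_trans (_ : #|above ([set enum_val i] :|: B)| * (128 * 100 * (lam * s)) ^ #|B| <= _).
      rewrite leq_mul2r; apply/orP; right; apply/subset_leq_card/subsetP => g.
      by rewrite !inE => /andP[].
    have := card_above_le ([set enum_val i] :|: B).
    case: (set_0Vmem (above ([set enum_val i] :|: B))) => [->|[g0 hg0]]; first by rewrite cards0.
    have := hg0; rewrite inE => /subset_leq_card; rewrite card_graph cardsU1 iB add1n => Bn.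
    have -> : n - #|B|.+1 = n.-1 - #|B| by lia.
    move=> le; apply: leq_trans (leq_mul le (leqnn _)) _; rewrite mulnC.
    by apply: expn_fact_le; move: hn s_gt1 lam_gt10 Bn; clear; nia.
  - by move=> i; rewrite fact_gt0.
  - by move=> i; apply: hG; apply: enum_valP.
have gF i : g i \in F by have := gG i; rewrite inE => /andP[/setIP[]].
have gE i e : e \in E -> ~~ intersecting (g i) e.
  by have := gG i; rewrite inE => /andP[_ /forall_inP]; apply.
have ginj : injective g.
  move=> i i' e; apply: contraTeq (intersecting_refl (g i) n0) => ne.
  by rewrite intersectingE negbK {2}e dg.
have cD : #|E :|: [set g i | i : 'I_#|Q|]| = #|E| + #|Q|.
  rewrite cardsU (_ : _ :&: _ = set0); first by rewrite cards0 subn0 card_imset // card_ord.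
  apply/setP => h; rewrite !inE; apply/negbTE/negP => /andP[hE /imsetP[i _ e]].
  by have := gE i h hE; rewrite -e intersecting_refl.
rewrite -cD; apply: nuF.
  by rewrite subUset EF; apply/subsetP => _ /imsetP[i _ ->].
apply/forall_inP => h /setUP[hE|/imsetP[i _ ->]]; apply/forall_inP => h' /setUP[h'E|/imsetP[i' _ ->]];
  apply/implyP => ne.
- by have /forall_inP/(_ h' h'E)/implyP := Enon h hE; apply.
- by rewrite intersecting_sym gE.
- by rewrite gE.
- rewrite intersectingE negbK dg //; by apply: contraNneq ne => ->.
Qed.

Hypothesis F_large : (s.-1 * (n.-1)`!).+1 <= #|F| + d_n1 n.
Let U := \bigcup_(c in P) star c.
Let f2 := (n - 2)`!.

Let f1E : (n.-1)`! = n.-1 * f2.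
Proof. by rewrite /f2 -{1}(@prednK n.-1) ?factS ?subn2 ?prednK //; lia. Qed.

(** As [n * n.-1 <= 4 * 2^(2 lam)], [F2_small] leaves at most [4 * (n - 2)! / 2^(4 lam)]
    permutations, and [lam > 10]. *)
Let F2_tiny : 1000 * #|F2| <= f2.
Proof.
have fE : n`! = n * n.-1 * f2 by rewrite -{1}(@prednK n) ?factS ?prednK ?f1E ?mulnA //; lia.
move: F2_small; rewrite fE mulnC expnM mulnC; move: hlam; rewrite expnS.
have -> : 2 ^ 6 = 64 by [].
have -> : 64 ^ lam = 2 ^ lam * 2 ^ lam * (2 ^ lam * 2 ^ lam * (2 ^ lam * 2 ^ lam)).
  by rewrite -!expnD -[64]/(2 ^ 6) -expnM; congr (2 ^ _); lia.
have : 2 ^ 11 <= 2 ^ lam by rewrite leq_pexp2l.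
rewrite -[2 ^ 11]/2048; move: (2 ^ lam) #|F2| f2 => p a f p1 np h.
have nn : n * n.-1 <= 4 * (p * p) by nia.
have p0 : 0 < p * p by nia.
have : a * (p * p * (p * p)) <= 4 * f.
  rewrite -(leq_pmul2l p0); apply: leq_trans (_ : n * n.-1 * f <= _); last by nia.
  by apply: leq_trans h; rewrite -!mulnA; lia.
have : 4000 <= p * p * (p * p) by nia.
move: (p * p * (p * p)) => q; nia.
Qed.

Let F2_tiny1 : 1000 * #|F2| <= (n.-1)`!.
Proof. by apply: leq_trans F2_tiny _; rewrite f1E leq_pmull //; lia. Qed.

Let F2P p c : p \in F2 -> c \in P -> c \notin graph p.
Proof.
rewrite inE => /andP[pU _] cin; apply: contra pU => cp.
by apply/bigcupP; exists c => //; rewrite in_star.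
Qed.

Let F_split : #|F :&: U| + #|F2| = #|F|.
Proof. exact: cardsID. Qed.

Let card_U : #|U| <= s.-1 * (n.-1)`!.
Proof.
apply: leq_trans (card_bigcup_le _ _) _; rewrite (eq_bigr (fun=> (n.-1)`!)).
  by rewrite sum_nat_const cP.
by move=> c _; rewrite card_star.
Qed.

Let card_missing : #|U :\: F| < d_n1 n + #|F2|.
Proof. by have := cardsID F U; rewrite setIC; move: F_split F_large card_U; lia. Qed.

(** Suppose each star has a member of [F] avoiding [p] and the other stars. If each keeps a
    hundredth of [(n.-1)!] members avoiding [p], then [p] extends by all [s.-1] stars. Otherwise one
    star accounts for nearly all missing permutations; with a member [g0] of it, [p] and [g0] extend
    by the other [s.-2] stars. Either way [F] has [s] disjoint members. *)
Lemma star_blocked p : p \in F2 -> exists2 c, c \in P &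
  forall g, g \in F -> g \in avoid c p -> exists2 c', c' \in P :\ c & g \in star c'.
Proof.
move=> pF2; have pF : p \in F by move: pF2; rewrite inE => /andP[].
have n1 : 1 < n by apply: leq_trans n_large.
pose free c := [set g in F :&: avoid c p | [forall c' in P :\ c, g \notin star c']].
case: (pickP (fun c => (c \in P) && (free c == set0))) => [c /andP[cin /eqP c0]|none].
  exists c => // g gF gav; apply/exists_inP; apply: contraT => /exists_inPn h.
  by rewrite -(in_set0 g) -c0 inE in_setI gF gav; apply/forall_inP.
exfalso; have sub1 : [set p] \subset F by rewrite sub1set.
have non1 : pairwise_nonint [set p].
  apply/forall_inP => x /set1P->; apply/forall_inP => y /set1P->; by rewrite eqxx.
have avE c : F :&: avoid c p = [set g in F :&: star c | [forall e in [set p], ~~ intersecting g e]].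
  apply/setP => g; rewrite !inE -andbA; congr [&& _, _ & _].
  by apply/idP/forall_inP => [h e /set1P->//|h]; apply: h; rewrite inE.
case: (pickP (fun c => (c \in P) && (100 * #|F :&: avoid c p| < (n.-1)`!))) => [c|all]; last first.
  have := @extend_matching [set p] P; rewrite cards1 cP => /(_ _ sub1 non1).
  have -> : (1 + s.-1 < s) = false by move: s_gt1; clear; lia.
  move=> h; have : false; last by []. apply: h; first by clear; lia.
  by move=> c cin; have := all c; rewrite cin -avE /= => /negbT; rewrite -leqNgt.
case/andP=> cin small; have /set0Pn[g0] : free c != set0 by have := none c; rewrite cin => /negbT.
rewrite inE => /andP[/setIP[g0F g0av] /forall_inP g0free].
move: (g0av); rewrite inE => /andP[g0c g0p].
have sub2 : [set p; g0] \subset F by rewrite subUset !sub1set pF.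
have non2 : pairwise_nonint [set p; g0].
  apply/forall_inP => x /set2P[]->; apply/forall_inP => y /set2P[]->;
    rewrite ?eqxx //; apply/implyP => _ //.
  by rewrite intersecting_sym.
have pg0 : p != g0.
  by apply: contraNneq g0p => ->; rewrite intersecting_refl // ltnW.
have := @extend_matching [set p; g0] (P :\ c); rewrite cards2 pg0.
have cPc : #|P :\ c| = s.-2 by move: (cardsD1 c P) s_gt1; rewrite cin cP; clear; lia.
rewrite cPc => /(_ _ sub2 non2).
have -> : (2 + s.-2 < s) = false by move: s_gt1; clear; lia.
move=> h; have : false; last by []. apply: h; first by clear; lia.
move=> c' c'P; set G := [set g in _ | _].
have c'in : c' \in P by case/setD1P: c'P.
pose A2 := [set g in above [set c'] | ~~ intersecting g p & ~~ intersecting g g0].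
have dj q : c' \notin graph q -> [disjoint [set c'] & graph q] by rewrite disjoints1.
have A2_large : (n.-1)`! <= 42 * #|A2|.
  rewrite -(card_star c'); apply: card_avoid_two => //.
  - by apply: dj; apply: F2P.
  - by apply: dj; rewrite -in_star g0free.
  - by rewrite cards1.
  - by apply/card_gt0P; rewrite card_above1 fact_gt0.
have A2G : F :&: A2 \subset G.
  apply/subsetP => g; rewrite !inE => /andP[-> /and3P[-> gp gg0]] /=.
  by apply/forall_inP => e /set2P[]->.
have A2miss : (A2 :\: F) :|: (avoid c p :\: F) \subset U :\: F.
  apply/subsetP => g; rewrite !inE => /orP[/andP[-> /andP[gc' _]]|/andP[-> /andP[gc _]]] /=;
    apply/bigcupP; [exists c'|exists c] => //; by rewrite inE.
(* Members of [A2] avoid [g0], whose graph contains [c], so they lie outside [star c] and the two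
   losses add up. *)
have dis : (A2 :\: F) :&: (avoid c p :\: F) = set0.
  apply/setP => g; rewrite in_set0; apply/negbTE/negP; rewrite !inE !sub1set.
  move=> /andP[/andP[_ /and3P[_ _ gg0]] /andP[_ /andP[gc _]]].
  move: gg0; rewrite intersectingE negbK => /disjointFr/(_ gc).
  by rewrite -in_star g0c.
(* [F] lacks fewer than [d_n1 n + #|F2|] members of the stars, and [star c] uses up all but a
   hundredth of [(n.-1)!] of [d_n1 n]; so [A2] keeps a fraction [1/42 - 1/100 - 1/1000 > 1/100]. *)
have := subset_leq_card A2miss; rewrite -[#|_ :|: _|]addn0 -(cards0 perm_n) -dis cardsUI.
have := cardsID F A2; have := cardsID F (avoid c p); rewrite (card_avoid n1 (F2P pF2 cin)).
have := subset_leq_card A2G; rewrite ![F :&: _]setIC in small *.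
move: card_missing F2_tiny1 A2_large small; clear; lia.
Qed.
(** The other stars contain the members of [F] in [Y], so [Y] can be cut out of [star c] before
    counting. *)
Let bound_one c (Y : {set perm_n}) : c \in P -> Y \subset star c ->
  (forall g, g \in F -> g \in Y -> exists2 c', c' \in P :\ c & g \in star c') ->
  #|F :&: U| + #|Y| <= s.-1 * (n.-1)`!.
Proof.
move=> cin Yc hY.
have sub : F :&: U \subset \bigcup_(e in P :\ c) star e :|: (star c :\: Y).
  apply/subsetP => g /setIP[gF /bigcupP[e eP ge]]; rewrite inE.
  case: (eqVneq e c) => [ec|ec]; last first.
    by apply/orP; left; apply/bigcupP; exists e; rewrite // in_setD1 ec.
  rewrite -ec in_setD ge andbT; case: (boolP (g \in Y)) => gY; last by rewrite orbT.
  by have [e' e'P ge'] := hY g gF gY; rewrite orbF; apply/bigcupP; exists e'; rewrite // ?ec.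
have := leq_trans (subset_leq_card sub) (leq_card_setU _ _).
have := cardsID Y (star c); rewrite (setIidPr Yc) card_star.
have : #|\bigcup_(e in P :\ c) star e| <= #|P :\ c| * (n.-1)`!.
  apply: leq_trans (card_bigcup_le _ _) _; rewrite -sum_nat_const.
  by apply: leq_sum => e _; rewrite card_star.
move: (cardsD1 c P); rewrite cin cP; clear.
move: #|P :\ c| #|F :&: U| #|\bigcup_(_ in _) _| #|_ :\: _| (_`!) => a b u v f.
move=> e h1 h2 h3; rewrite e mulnDl mul1n; lia.
Qed.

(** Both permutations block a star. If it is the same one, it loses at least [(n - 2)! / 42] beyond
    [d_n1 n]. If the stars differ, the loss is [2 * d_n1 n] up to their intersection, of size at
    most [(n - 2)!]. [F2] is too small to make up for either. *)
Lemma F2_unique p p' : p \in F2 -> p' \in F2 -> p = p'.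
Proof.
move=> pF2 p'F2; apply: contraTeq (pF2) => ne; exfalso.
have n1 : 1 < n by apply: leq_trans n_large.
have [c cin hc] := star_blocked pF2; have [c' c'in hc'] := star_blocked p'F2.
have cp := F2P pF2 cin; have c'p' := F2P p'F2 c'in.
case: (eqVneq c c') => [cc'|cc'].
  rewrite -{c'}cc' in c'in hc' c'p'.
  have Yc : avoid c p :|: avoid c p' \subset star c.
    by apply/subsetP => g; rewrite !inE => /orP[]/andP[].
  have hY g : g \in F -> g \in avoid c p :|: avoid c p' ->
      exists2 e, e \in P :\ c & g \in star e.
    by move=> gF /setUP[]; [apply: hc|apply: hc'].
  have := bound_one cin Yc hY.
  have -> : #|avoid c p :|: avoid c p'| = d_n1 n + #|avoid c p' :\: avoid c p|.
    rewrite -(card_avoid n1 cp) -(cardsID (avoid c p) (_ :|: _)); congr (_ + _).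
      by rewrite setUK.
    by rewrite setDUl setDv set0U.
  have := card_avoid_diff n_large ne cp c'p'; rewrite -/f2; move: F2_tiny F_split F_large; clear.
  have : 0 < f2 by rewrite fact_gt0.
  move: f2 => f; lia.
have inter : #|star c :&: star c'| <= f2.
  rewrite /f2; have <- : #|[set c; c']| = 2 by rewrite cards2 cc'.
  apply: leq_trans (card_above_le _); apply/subset_leq_card/subsetP => g.
  by rewrite !inE subUset => /andP[-> ->].
have sub : F :&: U \subset \bigcup_(e in P :\ c :\ c') star e :|:
    (star c :\: avoid c p) :|: (star c' :\: avoid c' p') :|: (star c :&: star c').
  apply/subsetP => g /setIP[gF /bigcupP[e eP ge]]; rewrite !in_setU !in_setD in_setI.
  case gc: (g \in star c); case gc': (g \in star c'); rewrite /= ?andbT ?andbF ?orbT ?orbF //.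
  - case: (boolP (g \in avoid c p)) => gav; last by rewrite orbT.
    have [e' e'P ge'] := hc g gF gav; rewrite orbF; apply/bigcupP; exists e' => //.
    by rewrite in_setD1 e'P andbT; apply: contraFneq gc' => <-.
  - case: (boolP (g \in avoid c' p')) => gav; last by rewrite orbT.
    have [e' /setD1P[e'c' e'P] ge'] := hc' g gF gav; rewrite orbF; apply/bigcupP; exists e' => //.
    by rewrite !in_setD1 e'P e'c' andbT; apply: contraFneq gc => <-.
  - apply/bigcupP; exists e => //; rewrite !in_setD1 eP andbT.
    by apply/andP; split; [apply: contraFneq gc'|apply: contraFneq gc] => <-.
have := leq_trans (subset_leq_card sub) (leq_trans (leq_card_setU _ _) (leq_add
  (leq_trans (leq_card_setU _ _) (leq_add (leq_card_setU _ _) (leqnn _))) (leqnn _))).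
have sav (e : cell) (q : perm_n) : #|star e :\: avoid e q| + #|avoid e q| = (n.-1)`!.
  rewrite -(card_star e) -(cardsID (avoid e q) (star e)) addnC; congr (_ + _).
  by apply: eq_card => g; rewrite in_setI inE; case: (g \in star e).
have := sav c p; have := sav c' p'; rewrite (card_avoid n1 cp) (card_avoid n1 c'p').
have : #|\bigcup_(e in P :\ c :\ c') star e| <= #|P :\ c :\ c'| * (n.-1)`!.
  apply: leq_trans (card_bigcup_le _ _) _; rewrite -sum_nat_const.
  by apply: leq_sum => e _; rewrite card_star.
have d42 : (n.-1)`! <= 42 * d_n1 n by apply: d_n1_lower cp.
have c2 : s.-1 = #|P :\ c :\ c'| + 2.
  have := cardsD1 c' (P :\ c); rewrite in_setD1 eq_sym cc' c'in.
  by have := cardsD1 c P; rewrite cin cP; clear; lia.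
have f100 : 100 * f2 <= (n.-1)`!.
  by rewrite f1E leq_mul2r; apply/orP; right; move: n_large; clear; lia.
move: d42 f100 inter F2_tiny F_split F_large; rewrite c2 mulnDl; clear.
have : 0 < f2 by rewrite fact_gt0.
move: f2 => f; lia.
Qed.

(** With [F2 = [set p]], the blocked star loses its [d_n1 n] members avoiding [p], so [F_large] is
    tight. Then [F :&: U] is the full union of the stars reduced in this way, and these are pairwise
    disjoint. *)
Lemma extremal_structure : F2 != set0 -> #|F| + d_n1 n = (s.-1 * (n.-1)`!).+1 /\ exists p c,
  [/\ c \in P, forall e, e \in P -> e \notin graph p,
     forall e e', e \in P -> e' \in P -> (e.1 == e'.1) || (e.2 == e'.2) &
     F = \bigcup_(e in P :\ c) star e :|: (Sigma_int p :&: star c) :|: [set p]].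
Proof.
case/set0Pn=> p pF2; have n1 : 1 < n by apply: leq_trans n_large.
have F2E : F2 = [set p].
  apply/setP => q; rewrite inE; apply/idP/eqP => [qF2|->//]; exact: F2_unique.
have [c cin hc] := star_blocked pF2; have cp := F2P pF2 cin.
have avc : avoid c p \subset star c by apply/subsetP => g; rewrite inE => /andP[].
have le := bound_one cin avc hc; rewrite (card_avoid n1 cp) in le.
have cF2 : #|F2| = 1 by rewrite F2E cards1.
have eqF : #|F| + d_n1 n = (s.-1 * (n.-1)`!).+1.
  by move: le F_large F_split; rewrite cF2; clear; lia.
split=> //; exists p, c.
pose X e := if e == c then star c :\: avoid c p else star e.
have sub : F :&: U \subset \bigcup_(e in P) X e.
  apply/subsetP => g /setIP[gF /bigcupP[e eP ge]]; apply/bigcupP.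
  case: (eqVneq e c) => [ec|ec]; last by exists e; rewrite // /X (negPf ec).
  case: (boolP (g \in avoid c p)) => gav.
    have [e' /setD1P[e'c e'P] ge'] := hc g gF gav.
    by exists e' => //; rewrite /X (negPf e'c).
  by exists c => //; rewrite /X eqxx in_setD gav -ec.
have sumX : \sum_(e in P) #|X e| + d_n1 n = s.-1 * (n.-1)`!.
  rewrite (bigD1 c) //= {1}/X eqxx (eq_bigr (fun=> (n.-1)`!)); last first.
    by move=> e /andP[_ /negPf ec]; rewrite /X ec card_star.
  have := cardsID (avoid c p) (star c); rewrite (setIidPr avc) card_star (card_avoid n1 cp).
  rewrite (eq_bigl (fun e => e \in P :\ c)) => [|e]; last by rewrite in_setD1 andbC.
  rewrite sum_nat_const -cP (cardsD1 c P) cin mulnDl mul1n.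
  by move=> e; rewrite addnAC [_ + d_n1 n]addnC e.
have cU : #|F :&: U| = \sum_(e in P) #|X e|.
  by move: sumX eqF F_split; rewrite cF2; clear; lia.
have FUX : F :&: U = \bigcup_(e in P) X e.
  by apply/eqP; rewrite eqEcard sub cU card_bigcup_le.
have noover e e' g : e \in P -> e' \in P -> e != e' -> g \in X e -> g \in X e' -> False.
  move=> eP e'P ee' ge ge'; have := card_bigcup_lt eP e'P ee' ge ge'.
  by rewrite -FUX cU ltnn.
split=> //.
- by move=> e eP; apply: F2P.
- move=> e e' eP e'P; apply: contraT; rewrite negb_or => /andP[n1e n2e].
  have [g [ge ge' gp]] := perm_through_two_meeting n_large p n1e n2e.
  (* Meeting [p] keeps [g] in the reduced star of [c], so [g] lies in two of the sets [X]. *)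
  have inX f : g \in star f -> g \in X f.
    rewrite /X; case: eqP => // -> gc; rewrite in_setD gc andbT inE gc /= negbK //.
  case: (noover e e' g eP e'P) => //; try exact: inX.
  by apply: contraNneq n1e => ->.
rewrite -(setID F U) -/F2 F2E FUX; congr (_ :|: _).
rewrite (bigD1 c) //= {1}/X eqxx setUC; congr (_ :|: _).
  apply: eq_big => e; first by rewrite in_setD1 andbC.
  by case/andP=> _ /negPf ec; rewrite /X ec.
by apply/setP => g; rewrite in_setD in_setI [g \in avoid _ _]inE [g \in Sigma_int p]inE;
   case: (g \in star c); rewrite ?andbT ?andbF //= negbK.
Qed.
End Extremal.

(** * The extremal family *)

Section NormalForm.
Variables (n s : nat) (o0 : 'I_n).
Hypothesis o0E : val o0 = 0.
Local Notation perm_n := {perm 'I_n}.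
Local Notation cell := ('I_n * 'I_n)%type.

Lemma perm_initial (Y : {set 'I_n}) y0 : y0 \in Y ->
  exists r : perm_n, r o0 = y0 /\ forall i : 'I_n, (r i \in Y) = (i < #|Y|).
Proof.
move=> y0Y; pose l := enum Y ++ enum (~: Y).
have szl : size l = n by rewrite size_cat -!cardE cardsC card_ord.
have ul : uniq l.
  rewrite cat_uniq !enum_uniq andbT /=; apply/hasPn => y.
  by rewrite !mem_enum inE.
have inj : injective (fun i : 'I_n => nth y0 l i).
  by move=> i j /eqP; rewrite nth_uniq ?szl // => /eqP/val_inj.
pose r1 : perm_n := perm inj.
have r1Y i : (r1 i \in Y) = (i < #|Y|).
  rewrite permE nth_cat -cardE; case: ltnP => [lt|le].
    by rewrite -mem_enum mem_nth // -cardE.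
  have : nth y0 (enum (~: Y)) (i - #|Y|) \in enum (~: Y).
    by rewrite mem_nth // -cardE; have := cardsC Y; have := ltn_ord i; rewrite card_ord; lia.
  by rewrite mem_enum inE => /negPf.
have Y0 : 0 < #|Y| by apply/card_gt0P; exists y0.
exists (tperm o0 (r1^-1%g y0) * r1)%g; rewrite permM tpermL permKV; split=> // i.
have lt0 : r1^-1%g y0 < #|Y| by rewrite -r1Y permKV.
rewrite permM r1Y; case: tpermP => [->|->|//]; first by rewrite lt0 o0E.
by rewrite lt0 o0E.
Qed.

Lemma in_F0 (sigma g : perm_n) : (g \in F0 s sigma) =
  [|| 0 < val (g o0) < s.-1, intersecting g sigma && (g o0 == o0) | g == sigma].
Proof.
have pt1 x : is_pt1 x = (x == o0) by rewrite -(inj_eq val_inj) o0E.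
rewrite /F0 (eq_bigl _ _ pt1) big_pred1_eq !inE -orbA; congr (_ || _).
apply/bigcupP/idP => [[y hy]|h]; first by rewrite inE => /eqP ->.
by exists (g o0) => //; rewrite inE.
Qed.

(** Membership in [F0] depends only on the value at [o0], on meeting [sigma] and on being [sigma];
    [r] carries the initial segment to [Y]. The value [v] is [f x0] for a row and [f^-1 y0] for a
    column. *)
Lemma F0_transfer (Y : {set 'I_n}) y0 (r : perm_n) (sigma g p f : perm_n) v :
  #|Y| = s.-1 -> r o0 = y0 -> (forall i : 'I_n, (r i \in Y) = (i < #|Y|)) ->
  r (g o0) = v -> intersecting g sigma = intersecting f p -> (g == sigma) = (f == p) ->
  (g \in F0 s sigma) = [|| v \in Y :\ y0, intersecting f p && (v == y0) | f == p].
Proof.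
move=> cY r0 rY <- eint eeq; rewrite in_F0 eint eeq in_setD1 rY cY -r0 (inj_eq perm_inj).
by congr [|| _ && _, _ | _]; rewrite -(inj_eq val_inj) o0E lt0n.
Qed.

Variables (P : {set cell}) (c : cell) (p : perm_n) (F : {set perm_n}).
Hypothesis cP : #|P| = s.-1.
Hypothesis cin : c \in P.
Hypothesis Pp : forall e, e \in P -> e \notin graph p.
Hypothesis FE : F = \bigcup_(e in P :\ c) star e :|: (Sigma_int p :&: star c) :|: [set p].

Let inF f : (f \in F) = [|| [exists e in P :\ c, e \in graph f],
   intersecting f p && (c \in graph f) | f == p].
Proof.
rewrite FE !in_setU in_setI in_set1 -orbA [f \in Sigma_int p]inE in_star; congr (_ || _).
by apply/bigcupP/exists_inP => [[e eP]|[e eP ef]]; exists e; rewrite // ?in_star // -in_star.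
Qed.

(** [pi] moves the row [x0] to [o0], [r] sends the initial segment to the columns [Y] of [P] with
    [o0] going to that of [c], and [sigma] is [p] in these coordinates. [sigma_cond] holds because
    [p] contains no cell of [P]. *)
Lemma row_normal_form : (forall e, e \in P -> e.1 = c.1) ->
  exists rho pi sigma : perm_n, sigma_cond s sigma /\ F = lrcomp rho pi (F0 s sigma).
Proof.
move: (cin) inF; case: c => x0 y0 /= c0P inF0 hrow.
pose Y := [set y | (x0, y) \in P].
have PE : P = [set (x0, y) | y in Y].
  apply/setP => -[x y]; apply/idP/imsetP => [xyP|[z + [-> ->]]]; last by rewrite inE.
  have /= xx := hrow _ xyP; rewrite xx in xyP *.
  by exists y; rewrite // inE.
have cY : #|Y| = s.-1 by rewrite -cP PE card_imset // => y y' [].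
have y0Y : y0 \in Y by rewrite inE.
have [r [r0 rY]] := perm_initial y0Y.
pose pi := tperm x0 o0; pose sigma := (pi^-1 * p * r^-1)%g.
exists r, pi, sigma; split.
  apply/forallP => x; apply/implyP => /eqP x0E; have -> : x = o0 by apply/val_inj; rewrite x0E.
  rewrite /sigma /pi tpermV !permM tpermR leqNgt -cY -rY permKV inE.
  by apply/negP => /Pp; rewrite in_graph eqxx.
apply/setP => f; pose g := (pi^-1 * f * r^-1)%g.
have fE : f = (pi * g * r)%g by rewrite /g -!mulgA mulVg mulg1 mulKVg.
have -> : (f \in lrcomp r pi (F0 s sigma)) = (g \in F0 s sigma).
  apply/imsetP/idP => [[h hF e]|gF]; last by exists g.
  by rewrite (_ : g = h) // /g e -!mulgA mulgV mulg1 mulKg.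
rewrite (F0_transfer (v := f x0) (f := f) (p := p) cY r0 rY); first last.
- by rewrite /g /sigma (inj_eq (mulIg _)) (inj_eq (mulgI _)).
- apply/existsP/existsP => -[z hz]; last first.
    by exists (pi z); rewrite /g /sigma !permM !permK (eqP hz).
  exists (pi^-1%g z); move: hz; by rewrite /g /sigma !permM (inj_eq perm_inj).
- by rewrite /g !permM permKV /pi tpermV tpermR.
rewrite inF0 in_graph; congr (_ || _).
apply/exists_inP/idP => [[[x y] /setD1P[ne xyP]]|].
  have /= xx := hrow _ xyP; rewrite xx in ne xyP *.
  rewrite in_graph => /eqP ->; rewrite in_setD1 inE xyP andbT.
  by apply: contraNneq ne => ->.
rewrite in_setD1 inE => /andP[ne fP]; exists (x0, f x0); last by rewrite in_graph.
by rewrite in_setD1 fP andbT xpair_eqE eqxx.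
Qed.

(** The row argument applied to inverses, which exchange rows and columns. *)
Lemma column_normal_form : (forall e, e \in P -> e.2 = c.2) ->
  exists rho pi sigma : perm_n, sigma_cond s sigma /\ F = lrcomp rho pi (setinv (F0 s sigma)).
Proof.
move: (cin) inF; case: c => x0 y0 /= c0P inF0 hcol.
pose Y := [set x | (x, y0) \in P].
have PE : P = [set (x, y0) | x in Y].
  apply/setP => -[x y]; apply/idP/imsetP => [xyP|[z + [-> ->]]]; last by rewrite inE.
  have /= yy := hcol _ xyP; rewrite yy in xyP *.
  by exists x; rewrite // inE.
have cY : #|Y| = s.-1 by rewrite -cP PE card_imset // => y y' [].
have x0Y : x0 \in Y by rewrite inE.
have [r [r0 rY]] := perm_initial x0Y.
pose rho := tperm o0 y0; pose sigma := (rho * p^-1 * r^-1)%g.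
exists rho, r^-1%g, sigma; split.
  apply/forallP => x; apply/implyP => /eqP x0E; have -> : x = o0 by apply/val_inj; rewrite x0E.
  rewrite /sigma /rho !permM tpermL leqNgt -cY -rY permKV inE.
  by apply/negP => /Pp; rewrite in_graph permKV eqxx.
apply/setP => f; pose g := (rho * f^-1 * r^-1)%g.
have -> : (f \in lrcomp rho r^-1 (setinv (F0 s sigma))) = (g \in F0 s sigma).
  apply/imsetP/idP => [[_ /imsetP[h hF ->] e]|gF].
    by rewrite (_ : g = h) // /g e !invMg !invgK -!mulgA mulgV mulg1 mulKVg.
  exists g^-1%g; first by apply/imsetP; exists g.
  by rewrite /g !invMg !invgK !mulgA mulVg mul1g mulgKV.
have intV (a b : perm_n) : intersecting a^-1 b^-1 = intersecting a b.
  apply/existsP/existsP => -[z /eqP hz].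
    by exists (a^-1%g z); rewrite permKV hz permKV.
  by exists (a z); rewrite permK hz permK.
rewrite (F0_transfer (v := f^-1%g y0) (f := f) (p := p) cY r0 rY); first last.
- by rewrite /g /sigma (inj_eq (mulIg _)) (inj_eq (mulgI _)) (inj_eq invg_inj).
- rewrite -[RHS]intV; apply/existsP/existsP => -[z hz]; last first.
    by exists (rho^-1%g z); rewrite /g /sigma !permM !permKV (eqP hz).
  exists (rho z); move: hz; by rewrite /g /sigma !permM (inj_eq perm_inj).
- by rewrite /g !permM permKV /rho tpermL.
have vE (x : 'I_n) : ((x, y0) \in graph f) = (f^-1%g y0 == x).
  by rewrite in_graph -(inj_eq (@perm_inj _ f^-1)) permK eq_sym.
rewrite inF0 vE; congr (_ || _).
apply/exists_inP/idP => [[[x y] /setD1P[ne xyP]]|].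
  have /= yy := hcol _ xyP; rewrite yy in ne xyP *.
  rewrite vE => /eqP ->; rewrite in_setD1 inE xyP andbT.
  by apply: contraNneq ne => ->.
rewrite in_setD1 inE => /andP[ne fP]; exists (f^-1%g y0, y0); last by rewrite vE.
by rewrite in_setD1 fP andbT xpair_eqE eqxx andbT.
Qed.
End NormalForm.

(** A cell [e1] off the row of [c] lies in its column; a cell off that column lies in the row of [c]
    and so shares no line with [e1]. *)
Lemma collinear_line (n : nat) (P : {set 'I_n * 'I_n}) c : c \in P ->
  (forall e e', e \in P -> e' \in P -> (e.1 == e'.1) || (e.2 == e'.2)) ->
  (forall e, e \in P -> e.1 = c.1) \/ (forall e, e \in P -> e.2 = c.2).
Proof.
move=> cin col; case: (boolP [forall e in P, e.1 == c.1]) => [/forall_inP h|].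
  by left=> e /h/eqP.
rewrite negb_forall_in => /exists_inP[e1 e1P ne1]; right=> e eP.
have /eqP e1c : e1.2 == c.2 by have := col _ _ e1P cin; rewrite (negPf ne1).
have := col _ _ eP cin; case: (e.2 =P c.2) => // ne2; rewrite orbF => /eqP e1e.
have := col _ _ eP e1P; rewrite e1c e1e eq_sym (negPf ne1) /= => /eqP//.
Qed.

(** * Matching and covering numbers, the size condition and the conclusion *)

Lemma tau_le n (F : {set {perm 'I_n}}) X : covers F X -> tau F <= #|X|.
Proof.
move=> cX; rewrite /tau; have := mem_index_enum X.
elim: (index_enum _) => // Y r IH; rewrite in_cons big_cons => /predU1P[<-|Xr].
  by rewrite cX geq_minl.
by case: ifP => _; rewrite ?geq_min IH ?orbT.
Qed.

Lemma nu_lt n s (F D : {set {perm 'I_n}}) :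
  nu F < s -> D \subset F -> pairwise_nonint D -> #|D| < s.
Proof.
move=> nus DF Dn; apply: leq_ltn_trans nus.
by rewrite /nu (bigmax_sup D) // DF Dn.
Qed.

Delimit Scope R_scope with Re.

(** Since [ln 2 >= 1/2], [ln n] is at least half of [trunc_log 2 n]: this turns the constant [2^17]
    into [2^16 = 256 * 256]. *)
Lemma size_cond_log n s : size_cond n s -> 0 < s ->
  1 < n /\ 256 * (256 * (trunc_log 2 n * s)) <= n.
Proof.
rewrite /size_cond => hs s0.
have s1 : (1 <= INR s)%Re by have := le_INR 1 s; apply; apply/leP.
case: n hs => [|[|n]] hs.
(* For [n <= 1] the quotient is 0: its numerator vanishes at [n = 0], and at [n = 1] the inverse of
   [ln 1 = 0] is 0. *)
- by exfalso; move: hs; rewrite /Rdiv /= Rmult_0_l; lra.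
- by exfalso; move: hs; rewrite /Rdiv /= ln_1 Rmult_0_r Rinv_0 Rmult_0_r; lra.
split=> //; set N := n.+2 in hs *; set lam := trunc_log 2 N.
have le : 2 ^ lam <= N by apply: trunc_logP.
have powINR k : INR (2 ^ k) = (2 ^ k)%Re.
  elim: k => [//|k IH]; rewrite expnS mult_INR IH /=; lra.
have lnN : (INR lam * / 2 <= ln (INR N))%Re.
  have h : (ln (2 ^ lam) <= ln (INR N))%Re.
    have : (2 ^ lam <= INR N)%Re by rewrite -powINR; apply: le_INR; apply/leP.
    case=> [lt|->]; last exact: Rle_refl.
    by left; apply: ln_increasing => //; apply: pow_lt; lra.
  rewrite ln_pow in h; last lra.
  apply: Rle_trans h; apply: Rmult_le_compat_l; first exact: pos_INR.
  by have := ln_lt_2; lra.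
have lam1 : 0 < lam by rewrite /lam trunc_log_gt0.
have lamR : (1 <= INR lam)%Re by have := le_INR 1 lam; apply; apply/leP.
have lnpos : (0 < ln (INR N))%Re by lra.
have den : (0 < INR 2 ^ 17 * ln (INR N))%Re.
  apply: Rmult_lt_0_compat => //; apply: pow_lt; rewrite /=; lra.
have h : (INR s * (INR 2 ^ 17 * ln (INR N)) <= INR N)%Re.
  have := Rmult_le_compat_r _ _ _ (Rlt_le _ _ den) hs.
  by rewrite /Rdiv Rmult_assoc Rinv_l ?Rmult_1_r //; lra.
apply/leP/INR_le; apply: Rle_trans h.
rewrite !mult_INR.
have -> : INR 256 = 256%Re by rewrite INR_IZR_INZ.
have -> : (INR 2 ^ 17 = 131072)%Re by rewrite /=; lra.
have : (INR lam * / 2 * INR s <= ln (INR N) * INR s)%Re by apply: Rmult_le_compat_r => //; lra.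
nra.
Qed.

Theorem theorem6 (n s : nat) (F : {set {perm 'I_n}}) :
  size_cond n s ->
  nu F < s ->
  s <= tau F ->
  ((#|F|%:Z <= (s%:Z - 1) * ((n.-1)`!)%:Z - (d_n1 n)%:Z + 1)%R
   /\
   ((#|F|%:Z = (s%:Z - 1) * ((n.-1)`!)%:Z - (d_n1 n)%:Z + 1)%R ->
    exists (rho pi sigma : {perm 'I_n}),
      sigma_cond s sigma /\
      (F = lrcomp rho pi (F0 s sigma) \/
       F = lrcomp rho pi (setinv (F0 s sigma))))).
Proof.
move=> hs nus taus.
have s0 : 0 < s by apply: leq_ltn_trans nus.
have [n1 hn] := size_cond_log hs s0.
have s1 : 1 < s.
  (* For [s = 1] the family would be empty and [tau F] would be 0. *)
  rewrite ltn_neqAle s0 andbT; apply/eqP => s1.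
  have F0 : F = set0.
    apply/eqP; apply: contraT => /set0Pn[p pF].
    have := @nu_lt n s F [set p] nus; rewrite sub1set cards1 -s1 ltnn; apply=> //.
    by apply/forall_inP => x /set1P->; apply/forall_inP => y /set1P->; rewrite eqxx.
  have : covers F set0 by apply/forall_inP => p; rewrite F0 inE.
  by move/tau_le; rewrite cards0 leqn0 => /eqP t0; rewrite t0 -s1 in taus.
set lam := trunc_log 2 n in hn.
have hlam : n < 2 ^ lam.+1 by apply: trunc_log_ltn.
have lam0 : 0 < lam by rewrite trunc_log_gt0.
have lam16 : 16 < lam.
  (* [2^lam.+1 > n >= 2^16 * lam * s >= 2^17]. *)
  rewrite -ltnS -(@ltn_exp2l 2) //; apply: leq_ltn_trans hlam; apply: leq_trans hn.
  rewrite -[17]/(8 + (8 + 1)) !expnD -[2 ^ 8]/256 !leq_pmul2l //.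
  by move: lam0 s1; clear; nia.
have n1000 : 1000 <= n by move: hn lam16 s1; clear; nia.
have nuF D := @nu_lt n s F D nus.
have no_matching (g : 'I_s -> {perm 'I_n}) : (forall i, g i \in F) ->
    ~ (forall i i', i != i' -> [disjoint graph (g i) & graph (g i')]).
  move=> gF dg; have ginj : injective g.
    move=> i i' e; apply: contraTeq (intersecting_refl (g i) (ltnW n1)) => ne.
    by rewrite intersectingE negbK {2}e dg.
  suff : #|[set g i | i : 'I_s]| < s by rewrite card_imset // card_ord ltnn.
  apply: nuF; first by apply/subsetP => _ /imsetP[i _ ->].
  apply/forall_inP => _ /imsetP[i _ ->]; apply/forall_inP => _ /imsetP[i' _ ->].
  by apply/implyP => ne; rewrite intersectingE negbK dg //; apply: contraNneq ne => ->.
have lam1 : 1 < lam by apply: leq_trans lam16.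
have [P [r [Ps rsmall FP]]] := star_approximation s0 lam1 hn hlam no_matching.
have -> : ((s%:Z - 1) * ((n.-1)`!)%:Z = (s.-1 * (n.-1)`!)%:Z)%R.
  by rewrite PoszM (_ : (s%:Z - 1 = s.-1%:Z)%R) //; move: s0; clear; lia.
case: (leqP (#|F| + d_n1 n) (s.-1 * (n.-1)`!)) => [small|large].
  split=> [|e]; first by move: small; clear; lia.
  by exfalso; move: small e; clear; lia.
case: (eqVneq #|P| s.-1) => [cP|nP]; last first.
  (* Each of the [s.-1 - #|P|] missing stars costs 15/16 of [(n.-1)!], while [d_n1 n] and [r] make
     up for at most [3/4 + 1/32] in all. *)
  exfalso; have Plt : #|P| < s.-1 by move: Ps nP; clear; lia.
  have d3 := d_n1_upper n1000.
  have r32 : 32 * r <= (n.-1)`!.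
    have h32 : 32 * n <= 2 ^ (6 * lam).
      apply: leq_trans (_ : 2 ^ (5 + lam.+1) <= _).
        by rewrite expnD leq_mul2l ltnW.
      by rewrite leq_pexp2l //; move: lam16; clear; lia.
    have fE : n`! = n * (n.-1)`! by rewrite -{1}(prednK (ltnW n1)) factS prednK // ltnW.
    rewrite -(leq_pmul2l (ltnW n1)) -fE; apply: leq_trans rsmall.
    by rewrite mulnA mulnC [n * 32]mulnC leq_mul2l h32 orbT.
  have : #|F| <= #|P| * (n.-1)`! + #|F :\: \bigcup_(c in P) star c|.
    rewrite -(cardsID (\bigcup_(c in P) star c) F) leq_add2r.
    apply: leq_trans (subset_leq_card (subsetIr _ _)) _.
    apply: leq_trans (card_bigcup_le _ _) _; rewrite -sum_nat_const.
    by apply: leq_sum => c _; rewrite card_star.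
  rewrite -(subnK (ltnW Plt)) in large FP *; rewrite addnK in FP.
  have u0 : (n.-1)`! <= (s.-1 - #|P|) * (n.-1)`! by rewrite leq_pmull // subn_gt0.
  by move: large FP d3 r32 u0; rewrite mulnDl; clear; lia.
have F2_small : #|F :\: \bigcup_(c in P) star c| * 2 ^ (6 * lam) <= n`!.
  apply: leq_trans rsmall; rewrite leq_mul2r; apply/orP; right.
  by move: FP; rewrite cP subnn mul0n add0n leq_mul2l.
have F2_neq0 : F :\: \bigcup_(c in P) star c != set0.
  (* Otherwise the [s.-1] cells of [P] would cover [F], against [s <= tau F]. *)
  apply/eqP => F20; have : covers F P.
    apply/forall_inP => p pF; apply/exists_inP.
    have /bigcupP[[x y] cin pc] : p \in \bigcup_(c in P) star c.
      by apply: contraT => pn; rewrite -(in_set0 p) -F20 in_setD pn.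
    by exists (x, y) => //; rewrite in_star_pair in pc.
  by move/tau_le; rewrite cP => /(leq_trans taus); move: s0; clear; lia.
have lam10 : 10 < lam by apply: leq_trans lam16.
have [eqF [p [c [cin Pp col FE]]]] :=
  extremal_structure s1 lam10 hn hlam nuF cP F2_small large F2_neq0.
split=> [|_]; first by move: eqF; clear; lia.
have n0 : 0 < n by apply: ltnW.
have [row|column] := collinear_line cin col.
  have [rho [pi [sigma [sc e]]]] := row_normal_form (o0 := Ordinal n0) erefl cP cin Pp FE row.
  by exists rho, pi, sigma; split; last left.
have [rho [pi [sigma [sc e]]]] := column_normal_form (o0 := Ordinal n0) erefl cP cin Pp FE column.
by exists rho, pi, sigma; split; last right.
Qed.
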